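(* Let $\Omega\subset\mathbb{R}^n$ ($n\ge2$) be a bounded domain, let $F$ satisfy (A1) and $\Phi$ satisfy (A2), and let $f\in L^n(\Omega)\cap C(\Omega)$. There is a constant $c>0$ depending only on $n,\lambda,i(\Phi),s(\Phi),L,\nu_0$ such that the following hold for every $u\in C(\overline\Omega)$ with boundary values $u=g$ on $\partial\Omega$. (i) If $u$ is a viscosity subsolution of $\Phi(x,|Du|)F(D^2u)=f$ in $\{x\in\Omega:u(x)>0\}$, then $$\sup_\Omega u\le\sup_{\partial\Omega}g^+ + c\,\mathrm{diam}(\Omega)\left(\max\left\{\|f^-\|_{L^n(\Gamma^+(u^+))}^{\frac{1}{i(\Phi)+1}},\ \|f^-\|_{L^n(\Gamma^+(u^+))}^{\frac{1}{s(\Phi)+1}}\right\}+1\right).$$ (ii) If $u$ is a viscosity supersolution of $\Phi(x,|Du|)F(D^2u)=f$ in $\{x\in\Omega:u(x)<0\}$, then $$\sup_\Omega u^-\le\sup_{\partial\Omega}g^- + c\,\mathrm{diam}(\Omega)\left(\max\left\{\|f^+\|_{L^n(\Gamma^+(u^-))}^{\frac{1}{i(\Phi)+1}},\ \|f^+\|_{L^n(\Gamma^+(u^-))}^{\frac{1}{s(\Phi)+1}}\right\}+1\right).$$ (iii) In particular, if $u$ satisfies the hypotheses of both (i) and (ii), then $$\|u\|_{L^\infty(\Omega)}\le\|g\|_{L^\infty(\partial\Omega)}+c\,\mathrm{diam}(\Omega)\left(\max\left\{\|f\|_{L^n(\Omega)}^{\frac{1}{i(\Phi)+1}},\ \|f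\|_{L^n(\Omega)}^{\frac{1}{s(\Phi)+1}}\right\}+1\right).$$
   Context: $\mathcal{S}(n)$ is the set of real symmetric $n\times n$ matrices; $h^+=\max\{h,0\}$, $h^-=\max\{-h,0\}$. (A1) $F:\mathcal{S}(n)\to\mathbb{R}$ is continuous, $F(0)=0$, and uniformly $(\lambda,\Lambda)$-elliptic with constants $0<\lambda\le\Lambda$: $\lambda\,\mathrm{tr}(N)\le F(M+N)-F(M)\le\Lambda\,\mathrm{tr}(N)$ for all $M,N\in\mathcal{S}(n)$ with $N\ge 0$. (A2) $\Phi:\Omega\times[0,\infty)\to[0,\infty)$ is continuous and: (1) there are constants $s(\Phi)\ge i(\Phi)>-1$ and $L\ge 1$ such that, for all $x\in\Omega$, $t\mapsto\Phi(x,t)/t^{i(\Phi)}$ is almost non-decreasing with constant $L$ on $(0,\infty)$ and $t\mapsto\Phi(x,t)/t^{s(\Phi)}$ is almost non-increasing with constant $L$ on $(0,\infty)$; (2) there are constants $0<\nu_0\le\nu_1$ with $\nu_0\le\Phi(x,1)\le\nu_1$ for all $x\in\Omega$. Here $h:(0,\infty)\to[0,\infty)$ is almost non-decreasing (resp. almost non-increasing) with constant $L$ if $h(s)\le L\,h(t)$ (resp. $h(t)\le L\,h(s)$) whenever $0<s\le t$. For $v:\Omega\to\mathbb{R}$ the upper contact set is $$\Gamma^+(v)=\Gamma^+(v,\Omega)=\{x\in\Omega:\exists\,p\in\mathbb{R}^n\text{ such that }v(y)\le v(x)+\langle p,y-x\rangle\text{ for all }y\in\Omega\}.$$ Viscosity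 sub/supersolutions: an upper (lower) semicontinuous function $u$ is a viscosity subsolution (supersolution) of $\Phi(x,|Du|)F(D^2u)=f$ in an open set $U$ if, whenever $\varphi\in C^2(U)$ and $u-\varphi$ has a local maximum (minimum) at $x_0\in U$, then $\Phi(x_0,|D\varphi(x_0)|)F(D^2\varphi(x_0))-f(x_0)\ge 0$ (resp. $\le 0$). *)

(* Defs.v *)
From HB Require Import structures.
From mathcomp Require Import all_boot all_order all_algebra.
From mathcomp Require Import all_classical all_reals all_analysis.

Set Implicit Arguments.
Unset Strict Implicit.
Unset Printing Implicit Defensive.

Import Order.TTheory GRing.Theory Num.Theory.
Import numFieldNormedType.Exports.

Local Open Scope classical_set_scope.
Local Open Scope ring_scope.

(** * Lebesgue measure on R^n

    ['rV[R]_n] carries the product sigma-algebra of the Borel sets of [R], i.e.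
    the Borel sigma-algebra of R^n, and Lebesgue measure is the n-fold product
    of the one-dimensional one. *)

Definition rV_display : measure_display. Proof. exact: default_measure_display. Qed.

Section measurable_rV.
Context {R : realType} {n : nat}.

Definition rV_coord (i : 'I_n) (v : 'rV[R]_n) : measurableTypeR R := v ord0 i.

Let rV_set0 : g_sigma_preimage rV_coord set0.
Proof. exact: sigma_algebra0. Qed.

Let rV_setC A : g_sigma_preimage rV_coord A -> g_sigma_preimage rV_coord (~` A).
Proof. exact: sigma_algebraC. Qed.

Let rV_bigcup (F : (set 'rV[R]_n)^nat) :
  (forall i, g_sigma_preimage rV_coord (F i)) ->
  g_sigma_preimage rV_coord (\bigcup_i (F i)).
Proof. exact: sigma_algebra_bigcup. Qed.

HB.instance Definition _ := @isMeasurable.Build rV_display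
  'rV[R]_n (g_sigma_preimage rV_coord) rV_set0 rV_setC rV_bigcup.

End measurable_rV.

Lemma measurable_rV_coord (R : realType) (n : nat) (i : 'I_n) :
  measurable_fun [set: 'rV[R]_n] (rV_coord i).
Proof.
move=> _ Y mY; rewrite setTI; apply: sub_sigma_algebra => /=.
rewrite -bigcup_seq/=; exists i => /=; first by rewrite mem_index_enum.
by exists Y => //; rewrite setTI.
Qed.

Lemma measurable_fun_rVP d (T : measurableType d) (R : realType) (n : nat)
    (h : T -> 'rV[R]_n) :
  (forall i, measurable_fun [set: T] (rV_coord i \o h)) ->
  measurable_fun [set: T] h.
Proof.
move=> mh _ A mA.
suff: g_sigma_preimage (fun i => rV_coord i \o h) `<=` measurable.
  by rewrite g_sigma_preimage_comp; apply; exists A.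
apply: smallest_sub; first exact: sigma_algebra_measurable.
case: n => [|n] in h mh A mA *; first by rewrite big_ord0.
rewrite -bigcup_mkord_ord; apply: bigcup_sub => i _.
by move=> _ [B mB <-]; exact: mh.
Qed.

Section rV_cons.
Context {R : realType} {n : nat}.

Definition rV_cons (xv : measurableTypeR R * 'rV[R]_n) : 'rV[R]_n.+1 :=
  \row_i if unlift ord0 i is Some j then xv.2 ord0 j else xv.1.

Definition rV_uncons (v : 'rV[R]_n.+1) : measurableTypeR R * 'rV[R]_n :=
  (v ord0 ord0, \row_j v ord0 (lift ord0 j)).

Lemma rV_consK : cancel rV_cons rV_uncons.
Proof.
move=> [x v]; rewrite /rV_uncons /rV_cons mxE unlift_none; congr pair.
by apply/rowP => j; rewrite !mxE liftK.
Qed.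

Lemma measurable_rV_cons : measurable_fun [set: _] rV_cons.
Proof.
apply: measurable_fun_rVP => i; rewrite /comp /rV_coord /rV_cons.
under eq_fun do rewrite mxE.
case: unliftP => [j|] _; last exact: measurable_fst.
exact: (measurableT_comp (@measurable_rV_coord R n j) measurable_snd).
Qed.

Lemma measurable_rV_uncons : measurable_fun [set: _] rV_uncons.
Proof.
apply/measurable_fun_pairP; split.
  exact: (@measurable_rV_coord R n.+1 ord0).
apply: measurable_fun_rVP => j; rewrite /comp /rV_coord /rV_uncons /=.
under eq_fun do rewrite mxE.
exact: (@measurable_rV_coord R n.+1 (lift ord0 j)).
Qed.

Variable mu : {sigma_finite_measure set 'rV[R]_n -> \bar R}.

Definition lebesgue_rV_cons : set 'rV[R]_n.+1 -> \bar R :=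
  pushforward (@lebesgue_measure R \x mu)%E rV_cons.

Let lebesgue_rV_cons0 : lebesgue_rV_cons set0 = 0%E.
Proof. by rewrite /lebesgue_rV_cons /pushforward preimage_set0 measure0. Qed.

Let lebesgue_rV_cons_ge0 A : (0 <= lebesgue_rV_cons A)%E.
Proof. by rewrite /lebesgue_rV_cons /pushforward; exact: measure_ge0. Qed.

Let lebesgue_rV_cons_sigma_additive : semi_sigma_additive lebesgue_rV_cons.
Proof.
exact: (@measure_semi_sigma_additive _ _ _
  (measure_function_pushforward__canonical__measure_function_Measure
    (@lebesgue_measure R \x mu)%E measurable_rV_cons)).
Qed.

HB.instance Definition _ := isMeasure.Build _ _ _ lebesgue_rV_cons
  lebesgue_rV_cons0 lebesgue_rV_cons_ge0 lebesgue_rV_cons_sigma_additive.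

Let lebesgue_rV_cons_sigma_finite : sigma_finite setT lebesgue_rV_cons.
Proof.
have /sigma_finiteP[F [FT ndF Foo]] := sigma_finiteT (@lebesgue_measure R).
have /sigma_finiteP[G [GT ndG Goo]] := sigma_finiteT mu.
have consE A : rV_cons @^-1` (rV_uncons @^-1` A) = A.
  by apply/seteqP; split => x; rewrite /preimage/= rV_consK.
exists (fun k => rV_uncons @^-1` (F k `*` G k)).
  apply/esym/seteqP; split=> // v _.
  have [i _ Fi] : (\bigcup_i F i) (rV_uncons v).1 by rewrite -FT.
  have [j _ Gj] : (\bigcup_j G j) (rV_uncons v).2 by rewrite -GT.
  exists (maxn i j) => //; split.
    by move: Fi; exact/subsetPset/ndF/leq_maxl.
  by move: Gj; exact/subsetPset/ndG/leq_maxr.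
move=> k; have [mF Fk] := Foo k; have [mG Gk] := Goo k; split.
  rewrite -[X in measurable X]setTI; apply: measurable_rV_uncons => //.
  exact: measurableX.
rewrite /lebesgue_rV_cons /pushforward consE product_measure1E//.
by rewrite lte_mul_pinfty// ge0_fin_numE.
Qed.

HB.instance Definition _ := Measure_isSigmaFinite.Build _ _ _ lebesgue_rV_cons
  lebesgue_rV_cons_sigma_finite.

End rV_cons.

Fixpoint lebesgue_rV (R : realType) (n : nat) :
    {sigma_finite_measure set 'rV[R]_n -> \bar R} :=
  if n is n'.+1 then lebesgue_rV_cons (lebesgue_rV R n') else \d_(0 : 'rV[R]_0).

Lemma lebesgue_rV_box (R : realType) (n : nat) (a b : 'rV[R]_n) :
  (forall i, a ord0 i <= b ord0 i) ->
  lebesgue_rV R n [set v | forall i, a ord0 i <= v ord0 i <= b ord0 i] =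
  (\prod_(i < n) (b ord0 i - a ord0 i))%:E.
Proof.
elim: n a b => [|n IHn] a b ab.
  rewrite big_ord0 /= diracE mem_set// => -[].
  by case.
pose a' : 'rV[R]_n := \row_j a ord0 (lift ord0 j).
pose b' : 'rV[R]_n := \row_j b ord0 (lift ord0 j).
rewrite big_ord_recl EFinM /= /lebesgue_rV_cons /pushforward.
have -> : rV_cons @^-1` [set v | forall i, a ord0 i <= v ord0 i <= b ord0 i] =
    `[a ord0 ord0, b ord0 ord0]%classic `*`
    [set v : 'rV[R]_n | forall i, a' ord0 i <= v ord0 i <= b' ord0 i].
  apply/seteqP; split => [[x v]/= H|[x v] /= [H0 H] i].
    split; first by have := H ord0; rewrite mxE unlift_none /= in_itv.
    by move=> i; have := H (lift ord0 i); rewrite !mxE liftK.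
  rewrite mxE; case: unliftP => [j ->|->] /=.
    by have := H j; rewrite !mxE.
  by move: H0; rewrite in_itv.
rewrite product_measure1E//=; last first.
  have -> : [set v : 'rV[R]_n | forall i, a' ord0 i <= v ord0 i <= b' ord0 i] =
    \bigcap_(i in [set: 'I_n]) (rV_coord i @^-1` `[a' ord0 i, b' ord0 i]%classic).
    apply/seteqP; split => [v H i _|v H i] /=; first by rewrite in_itv /=; exact: H.
    by have := H i I; rewrite /= in_itv.
  apply: fin_bigcap_measurable => // i _.
  rewrite -[X in measurable X]setTI; apply: measurable_rV_coord => //.
rewrite lebesgue_measure_itv /= lte_fin IHn; last by move=> i; rewrite !mxE; exact: ab.
congr (_ * _)%E.
  case: ltP => // ba; apply/esym/eqP; rewrite eqe subr_eq0 eq_le ba.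
  exact: ab.
by congr EFin; apply: eq_bigr => i _; rewrite !mxE.
Qed.

(** The norm of L^p(A). Outside [A] the restriction [f \_ A] is
    [point = 0 :> R]. *)
Definition Lnorm_on (R : realType) (n : nat) (A : set 'rV[R]_n) (p : \bar R)
    (f : 'rV[R]_n -> R) : \bar R :=
  Lnorm (lebesgue_rV R n) p (EFin \o (f \_ A)).

(** * Euclidean geometry of R^n

    The library norm on ['rV[R]_n] is the sup norm; it has the same topology
    and the same bounded sets, but lengths and diameters are Euclidean. *)

Definition dotv (R : realType) (n : nat) (p q : 'rV[R]_n) : R :=
  \sum_(i < n) p ord0 i * q ord0 i.

Definition enorm (R : realType) (n : nat) (p : 'rV[R]_n) : R :=
  Num.sqrt (dotv p p).

Definition diam (R : realType) (n : nat) (A : set 'rV[R]_n) : R :=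
  sup [set enorm (xy.1 - xy.2) | xy in A `*` A].

Definition boundary (T : topologicalType) (A : set T) : set T :=
  closure A `\` interior A.

Definition bounded_domain (R : realType) (n : nat) (A : set 'rV[R]_n) : Prop :=
  [/\ open A, connected A, A !=set0 & bounded_set A].

(** * Structural assumptions on the operator *)

Definition Sym (R : realType) (n : nat) : set 'M[R]_n :=
  [set M | M \is symmetricmx].

Definition psd (R : realType) (n : nat) (N : 'M[R]_n) : Prop :=
  forall v : 'rV[R]_n, 0 <= dotv (v *m N) v.

(** Only the values of [F] on [Sym R n] are constrained. *)
Definition elliptic_operator (R : realType) (n : nat) (lambda Lambda : R)
    (F : 'M[R]_n -> R) : Prop :=
  [/\ 0 < lambda <= Lambda,
      {within Sym (n:=n), continuous F},
      F 0 = 0 &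
      forall M N : 'M[R]_n, Sym M -> Sym N -> psd N ->
        lambda * \tr N <= F (M + N) - F M <= Lambda * \tr N].

Definition almost_nondecreasing (R : realType) (L : R) (h : R -> R) : Prop :=
  forall s t, 0 < s -> s <= t -> h s <= L * h t.

Definition almost_nonincreasing (R : realType) (L : R) (h : R -> R) : Prop :=
  forall s t, 0 < s -> s <= t -> h t <= L * h s.

(** Only the values of [Phi] on [Omega] x [0, +oo) are constrained;
    [iPhi] and [sPhi] are the exponents i(Phi) and s(Phi). *)
Definition degeneracy_law (R : realType) (n : nat) (Omega : set 'rV[R]_n)
    (iPhi sPhi L nu0 nu1 : R) (Phi : 'rV[R]_n -> R -> R) : Prop :=
  [/\ {within Omega `*` [set t : R | 0 <= t],
        continuous (fun xt : 'rV[R]_n * R => Phi xt.1 xt.2)},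
      forall x t, Omega x -> 0 <= t -> 0 <= Phi x t,
      [/\ -1 < iPhi, iPhi <= sPhi & 1 <= L],
      forall x, Omega x ->
        almost_nondecreasing L (fun t => Phi x t / t `^ iPhi) /\
        almost_nonincreasing L (fun t => Phi x t / t `^ sPhi) &
      0 < nu0 <= nu1 /\ forall x, Omega x -> nu0 <= Phi x 1 <= nu1].

(** * Viscosity solutions *)

Definition partial (R : realType) (n : nat) (i : 'I_n) (phi : 'rV[R]_n -> R)
    : 'rV[R]_n -> R :=
  fun x => 'D_(delta_mx ord0 i) phi x.

Definition gradient (R : realType) (n : nat) (phi : 'rV[R]_n -> R)
    (x : 'rV[R]_n) : 'rV[R]_n :=
  \row_i partial i phi x.

Definition hessian (R : realType) (n : nat) (phi : 'rV[R]_n -> R)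
    (x : 'rV[R]_n) : 'M[R]_n :=
  \matrix_(i, j) partial i (partial j phi) x.

Definition C1_on (R : realType) (n : nat) (U : set 'rV[R]_n)
    (phi : 'rV[R]_n -> R) : Prop :=
  {in U, continuous phi} /\
  forall i : 'I_n, {in U, forall x, derivable phi x (delta_mx ord0 i)} /\
                   {in U, continuous (partial i phi)}.

Definition C2_on (R : realType) (n : nat) (U : set 'rV[R]_n)
    (phi : 'rV[R]_n -> R) : Prop :=
  C1_on U phi /\ forall i : 'I_n, C1_on U (partial i phi).

Definition lsc_on (R : realType) (n : nat) (U : set 'rV[R]_n)
    (u : 'rV[R]_n -> R) : Prop :=
  lower_semicontinuous (EFin \o u : subspace U -> \bar R).

Definition usc_on (R : realType) (n : nat) (U : set 'rV[R]_n)
    (u : 'rV[R]_n -> R) : Prop :=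
  lsc_on U (- u).

Definition local_max (R : realType) (n : nat) (w : 'rV[R]_n -> R)
    (x0 : 'rV[R]_n) : Prop :=
  \forall x \near x0, w x <= w x0.

Definition local_min (R : realType) (n : nat) (w : 'rV[R]_n -> R)
    (x0 : 'rV[R]_n) : Prop :=
  \forall x \near x0, w x0 <= w x.

(** In both definitions [U] is meant to be open, so that the germ at a point of
    [U] of a function is determined by its values on [U]. *)
Definition viscosity_subsolution (R : realType) (n : nat)
    (Phi : 'rV[R]_n -> R -> R) (F : 'M[R]_n -> R) (f : 'rV[R]_n -> R)
    (U : set 'rV[R]_n) (u : 'rV[R]_n -> R) : Prop :=
  usc_on U u /\
  forall (phi : 'rV[R]_n -> R) (x0 : 'rV[R]_n),
    C2_on U phi -> U x0 -> local_max (u - phi) x0 ->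
    0 <= Phi x0 (enorm (gradient phi x0)) * F (hessian phi x0) - f x0.

Definition viscosity_supersolution (R : realType) (n : nat)
    (Phi : 'rV[R]_n -> R -> R) (F : 'M[R]_n -> R) (f : 'rV[R]_n -> R)
    (U : set 'rV[R]_n) (u : 'rV[R]_n -> R) : Prop :=
  lsc_on U u /\
  forall (phi : 'rV[R]_n -> R) (x0 : 'rV[R]_n),
    C2_on U phi -> U x0 -> local_min (u - phi) x0 ->
    Phi x0 (enorm (gradient phi x0)) * F (hessian phi x0) - f x0 <= 0.

Definition upper_contact_set (R : realType) (n : nat) (Omega : set 'rV[R]_n)
    (v : 'rV[R]_n -> R) : set 'rV[R]_n :=
  [set x | Omega x /\ exists p : 'rV[R]_n,
    forall y, Omega y -> v y <= v x + dotv p (y - x)].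

(** max (N ^ (1 / (i + 1)), N ^ (1 / (s + 1))) *)
Definition max_power (R : realType) (iPhi sPhi N : R) : R :=
  Num.max (N `^ (iPhi + 1)^-1) (N `^ (sPhi + 1)^-1).

(* Main.v *)
Require Import Defs.
From mathcomp Require Import all_boot all_order all_algebra.
From mathcomp Require Import all_classical all_reals all_analysis.
From mathcomp Require Import measurable_realfun ess_sup_inf ring lra.

Set Implicit Arguments.
Unset Strict Implicit.
Unset Printing Implicit Defensive.

Import Order.TTheory GRing.Theory Num.Theory.
Import numFieldNormedType.Exports.

Local Open Scope classical_set_scope.
Local Open Scope ring_scope.

(** Comparison with planes reduces everything to a bound on slopes.  Let [G] be
    the supremum of g^+ on the boundary and suppose that [u xs > G + M diam Omega]
    for some [xs] in Omega.  A plane of slope [p] with |p| <= M, lowered until it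
    touches the graph of [u] from above over the closure of Omega, stays above
    [G]; hence it touches at an interior point [x] where [u x > 0], and [x] lies
    in the upper contact set of u^+.  All slopes of a box [Pi] of side
    comparable with [M], located at distance comparable with [M] from the
    origin, thus occur at points of a compact set [A] of contact points, and it
    remains to bound the volume of [Pi] by an integral over [A].

    The volume is controlled without a concave envelope, second derivatives or
    the area formula.  The key fact ([contact_slope_gap]) is that two contact
    points at distance at most [s] have slopes [p], [q] with
    lambda |p - q| Phi <= 16 s f^-, where Phi and f^- are evaluated near the two
    points.  Indeed [u] lies below the minimum of two planes whose crease runs
    between the two points, and a quadratic barrier which is concave in the
    direction p - q and almost flat in the others touches [u] from above close to
    the crease.  A large ratio Lambda / lambda only widens the region in which
    the touching point may lie, and that region shrinks with [s]; this is why the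
    final constant depends on lambda but not on Lambda.

    Cutting R^n into small cubes of side [r], the slopes taken at contact points
    in one cube fill a box of side O(r sup f^- / Phi), so that summing over the
    cubes that meet [A] bounds the volume of [Pi] by an integral of (f^-)^n over a
    neighbourhood of [A] ([slope_covering]); shrinking the neighbourhood leaves
    the integral over [A] ([integral_nbhd_le], [abp_contact_estimate]).

    As all slopes involved have size comparable with [M >= 4], the almost
    monotonicity of Phi(x,t) / t^i bounds Phi below by a multiple of M^i, and the
    estimate reads M^(i+1) <= C ||f^-||.  Slopes of size at most 1 are never used,
    which accounts for the additive 1 ([abp_upper]).  The lower bound follows by
    applying the upper one to - u and the operator M |-> - F (- M). *)

(** * Euclidean geometry of row vectors *)

Section euclidean.
Context {R : realType} {n : nat}.
Implicit Types p q x y z : 'rV[R]_n.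

Lemma dotvC p q : dotv p q = dotv q p.
Proof. by apply: eq_bigr => i _; rewrite mulrC. Qed.

Lemma dotvDl p q x : dotv (p + q) x = dotv p x + dotv q x.
Proof. by rewrite /dotv -big_split; apply: eq_bigr => i _; rewrite mxE mulrDl. Qed.

Lemma dotvZl a p x : dotv (a *: p) x = a * dotv p x.
Proof. by rewrite /dotv mulr_sumr; apply: eq_bigr => i _; rewrite mxE mulrA. Qed.

Lemma dotvNl p x : dotv (- p) x = - dotv p x.
Proof. by rewrite -scaleN1r dotvZl mulN1r. Qed.

Lemma dotvBl p q x : dotv (p - q) x = dotv p x - dotv q x.
Proof. by rewrite dotvDl dotvNl. Qed.

Lemma dotvDr p q x : dotv x (p + q) = dotv x p + dotv x q.
Proof. by rewrite dotvC dotvDl !(dotvC _ x). Qed.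

Lemma dotvZr a p x : dotv x (a *: p) = a * dotv x p.
Proof. by rewrite dotvC dotvZl (dotvC _ x). Qed.

Lemma dotvBr p q x : dotv x (p - q) = dotv x p - dotv x q.
Proof. by rewrite dotvC dotvBl !(dotvC _ x). Qed.

Lemma dot0v x : dotv 0 x = 0.
Proof. by rewrite -(scale0r 0) dotvZl mul0r. Qed.

Lemma dotv_delta i x : dotv (delta_mx ord0 i) x = x ord0 i.
Proof.
rewrite /dotv (bigD1 i)//= big1 ?addr0; last first.
  by move=> j ji; rewrite mxE (negbTE ji) andbF mul0r.
by rewrite mxE !eqxx mul1r.
Qed.

Lemma dotvv_ge0 p : 0 <= dotv p p.
Proof. by apply: sumr_ge0 => i _; rewrite -expr2 sqr_ge0. Qed.

Lemma enorm_ge0 p : 0 <= enorm p. Proof. exact: sqrtr_ge0. Qed.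

Lemma sqr_enorm p : enorm p ^+ 2 = dotv p p.
Proof. by rewrite sqr_sqrtr// dotvv_ge0. Qed.

Lemma coord_le_enorm p i : `|p ord0 i| <= enorm p.
Proof.
rewrite -sqrtr_sqr ler_sqrt ?dotvv_ge0// /dotv (bigD1 i)//= expr2 lerDl.
by apply: sumr_ge0 => j _; rewrite -expr2 sqr_ge0.
Qed.

Lemma enorm_le_sum p : enorm p <= \sum_i `|p ord0 i|.
Proof.
have S0 : 0 <= \sum_i `|p ord0 i| by apply: sumr_ge0.
rewrite -(ler_pXn2r (n := 2)) ?nnegrE ?enorm_ge0// sqr_enorm expr2 mulr_sumr.
apply: ler_sum => i _; apply: le_trans (ler_norm _) _; rewrite normrM ler_wpM2r//.
by rewrite (bigD1 i)//= lerDl sumr_ge0.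
Qed.

Lemma enorm_le_coord p e : (forall i, `|p ord0 i| <= e) -> enorm p <= n%:R * e.
Proof.
move=> pe; apply: (le_trans (enorm_le_sum p)).
apply: (le_trans (ler_sum _ (fun i _ => pe i))).
by rewrite sumr_const card_ord mulr_natl.
Qed.

Lemma coord_le_norm p i : `|p ord0 i| <= `|p|.
Proof.
rewrite [leRHS]mx_normrE.
exact: (le_bigmax _ (fun ij : 'I_1 * 'I_n => `|p ij.1 ij.2|) (ord0, i)).
Qed.

Lemma norm_le_coord x (e : R) : 0 <= e -> (forall i, `|x ord0 i| <= e) -> `|x| <= e.
Proof.
move=> e0 xe; rewrite [leLHS]mx_normrE.
by apply: bigmax_le => // -[i j] _; rewrite /= ord1.
Qed.

Lemma norm_le_enorm p : `|p| <= enorm p.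
Proof. by apply: norm_le_coord => [|i]; [exact: enorm_ge0|exact: coord_le_enorm]. Qed.

Lemma enorm_le_norm p : enorm p <= n%:R * `|p|.
Proof. by apply: enorm_le_coord => i; exact: coord_le_norm. Qed.

Lemma enorm0_eq0 p : enorm p = 0 -> p = 0.
Proof.
move=> p0; apply/rowP => i; rewrite mxE; apply/eqP.
by rewrite -normr_le0 -p0 coord_le_enorm.
Qed.

Lemma enorm0 : enorm (0 : 'rV[R]_n) = 0.
Proof. by rewrite /enorm dot0v sqrtr0. Qed.

Lemma enormN p : enorm (- p) = enorm p.
Proof. by rewrite /enorm dotvNl dotvC dotvNl opprK. Qed.

Lemma dotv_le p q : dotv p q <= enorm p * enorm q.
Proof.
have [p0|p0] := eqVneq (enorm p) 0.
  by rewrite (enorm0_eq0 p0) dot0v enorm0 mul0r.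
have [q0|q0] := eqVneq (enorm q) 0.
  by rewrite (enorm0_eq0 q0) dotvC dot0v enorm0 mulr0.
have {}p0 : 0 < enorm p by rewrite lt_def p0 enorm_ge0.
have {}q0 : 0 < enorm q by rewrite lt_def q0 enorm_ge0.
have := dotvv_ge0 (enorm q *: p - enorm p *: q).
rewrite dotvBl !dotvBr !dotvZl !dotvZr -!sqr_enorm (dotvC q p) => H.
have : 0 <= (enorm p * enorm q) * (enorm p * enorm q - dotv p q) by nra.
by rewrite pmulr_rge0 ?mulr_gt0// subr_ge0.
Qed.

Lemma normr_dotv_le p q : `|dotv p q| <= enorm p * enorm q.
Proof.
rewrite ler_norml dotv_le andbT lerNl -dotvNl.
by apply: le_trans (dotv_le _ _) _; rewrite enormN.
Qed.

Lemma enormD p q : enorm (p + q) <= enorm p + enorm q.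
Proof.
rewrite -(ler_pXn2r (n := 2)) ?nnegrE ?addr_ge0 ?enorm_ge0// sqr_enorm.
rewrite dotvDl !dotvDr -!sqr_enorm (dotvC q p); have := dotv_le p q; nra.
Qed.

Lemma enormB p q : enorm (p - q) = enorm (q - p).
Proof. by rewrite -enormN opprB. Qed.

Lemma enormZ a p : enorm (a *: p) = `|a| * enorm p.
Proof. by rewrite /enorm dotvZl dotvZr mulrA -expr2 sqrtrM ?sqr_ge0// sqrtr_sqr. Qed.

Lemma continuous_sum (T : topologicalType) (I : Type) (r : seq I)
    (f : I -> T -> R) :
  (forall i, continuous (f i)) -> continuous (fun t => \sum_(i <- r) f i t).
Proof.
move=> cf; elim: r => [|i r IH].
  rewrite (_ : (fun _ => _) = cst 0); first exact: cst_continuous.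
  by apply/funext => t; rewrite big_nil.
rewrite (_ : (fun _ => _) = (fun t => f i t + \sum_(j <- r) f j t)).
  by move=> t; apply: cvgD; [exact: cf|exact: IH].
by apply/funext => t; rewrite big_cons.
Qed.

Lemma continuous_dotv (T : topologicalType) (f g : T -> 'rV[R]_n) :
  continuous f -> continuous g -> continuous (fun t => dotv (f t) (g t)).
Proof.
move=> cf cg; apply: continuous_sum => i t; apply: cvgM.
  exact: (continuous_comp (cf t) (@coord_continuous _ _ _ _ _ _)).
exact: (continuous_comp (cg t) (@coord_continuous _ _ _ _ _ _)).
Qed.

Lemma continuous_subv x : continuous (fun z : 'rV[R]_n => z - x).
Proof.
move=> z; exact: (@cvgB _ 'rV[R]_n _ (nbhs z) _ _ _ _ _ (@cvg_id _ (nbhs z)) (cvg_cst x)).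
Qed.

Lemma continuous_dotv_sub p x : continuous (fun z => dotv p (z - x)).
Proof.
by apply: continuous_dotv; [exact: cst_continuous|exact: continuous_subv].
Qed.

Lemma continuous_enorm (T : topologicalType) (f : T -> 'rV[R]_n) :
  continuous f -> continuous (fun t => enorm (f t)).
Proof.
move=> cf t; have cd := @continuous_dotv _ _ _ cf cf t.
exact: (continuous_comp cd (@sqrt_continuous _ _)).
Qed.

End euclidean.

(** * Quadratic test functions *)

Section quadratic_test.
Context {R : realType} {n : nat}.
Implicit Types p q x y z b e : 'rV[R]_n.

(** The remainder [k] is left free so that the increment can be produced by
    expanding the square, without any differentiation rule. *)
Lemma derive_quadratic_line (phi : 'rV[R]_n -> R) z v (l k : R) :
  (forall h, phi (h *: v + z) = phi z + h * l + h ^+ 2 * k) ->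
  derivable phi z v /\ 'D_v phi z = l.
Proof.
move=> H.
have C : (fun h => h^-1 *: ((phi \o shift z) (h *: v) - phi z)) @ 0^' --> l.
  apply: (@cvg_trans _ ((fun h : R => l + h * k) @ 0^')).
    apply: near_eq_cvg; near=> h.
    have h0 : h != 0 by near: h; exact: nbhs_dnbhs_neq.
    by rewrite /= H /GRing.scale/=; field.
  have C0 : (fun h : R => l + h * k) @ (0 : R) --> l + 0 * k.
    by apply: cvgD; [exact: cvg_cst|apply: cvgM; [exact: cvg_id|exact: cvg_cst]].
  rewrite mul0r addr0 in C0.
  by apply: cvg_trans C0; apply: cvg_app; exact: cvg_within.
split; first by apply/cvg_ex; exists l.
exact: cvg_lim C.
Unshelve. all: by end_near. Qed.

Definition quad_test (c : R) x b e (beta delta : R) z : R :=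
  c + dotv b (z - x) - beta / 2 * dotv e (z - x) ^+ 2
    + delta * dotv (z - x) (z - x).

Variables (c : R) (x b e : 'rV[R]_n) (beta delta : R).
Let phi := quad_test c x b e beta delta.

Lemma partial_quad_test i z :
  derivable phi z (delta_mx ord0 i) /\
  partial i phi z = b ord0 i - beta * e ord0 i * dotv e (z - x)
                      + 2 * delta * (z - x) ord0 i.
Proof.
apply: (derive_quadratic_line
  (k := - (beta / 2) * e ord0 i ^+ 2
    + delta * dotv (delta_mx ord0 i) (delta_mx ord0 i))) => h.
rewrite /phi /quad_test -(addrA _ z); move: (z - x) => y.
rewrite -(dotv_delta i b) -(dotv_delta i e) -(dotv_delta i y).
move: (delta_mx ord0 i) => d.
rewrite !(dotvDr, dotvZr, dotvDl, dotvZl) !(dotvC d).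
by field.
Qed.

Lemma partial_quad_testE i : partial i phi = fun z =>
  b ord0 i - beta * e ord0 i * dotv e (z - x) + 2 * delta * (z - x) ord0 i.
Proof. by apply/funext => z; have [] := partial_quad_test i z. Qed.

Lemma partial2_quad_test i j z :
  derivable (partial j phi) z (delta_mx ord0 i) /\
  partial i (partial j phi) z = 2 * delta * (i == j)%:R - beta * (e ord0 i * e ord0 j).
Proof.
rewrite partial_quad_testE; apply: (derive_quadratic_line (k := 0)) => h.
rewrite -(addrA _ z); move: (z - x) => y.
by rewrite !dotvDr !dotvZr (dotvC _ (delta_mx _ _)) dotv_delta !mxE eqxx/= eq_sym; ring.
Qed.

Lemma continuous_quad_test : continuous phi.
Proof.
move=> z; have ce := @continuous_dotv_sub _ _ e x z.
have cb := @continuous_dotv_sub _ _ b x z.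
have /(_ z) cx : continuous (fun z => dotv (z - x) (z - x)).
  by apply: continuous_dotv; exact: continuous_subv.
have ce2 := continuousM (@cst_continuous _ _ (beta / 2) z) (continuousM ce ce).
exact: (continuousD (continuousB (continuousD (@cst_continuous _ _ c z) cb) ce2)
  (continuousM (@cst_continuous _ _ delta z) cx)).
Qed.

Lemma continuous_partial_quad_test i : continuous (partial i phi).
Proof.
rewrite partial_quad_testE => z; have ce := @continuous_dotv_sub _ _ e x z.
have cx : {for z, continuous (fun z => (z - x) ord0 i)}.
  exact: (continuous_comp (@continuous_subv _ _ x z) (@coord_continuous _ _ _ _ _ _)).
exact: (continuousD
  (continuousB (@cst_continuous _ _ (b ord0 i) z)
    (continuousM (@cst_continuous _ _ (beta * e ord0 i) z) ce))
  (continuousM (@cst_continuous _ _ (2 * delta) z) cx)).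
Qed.

Lemma C2_on_quad_test U : C2_on U phi.
Proof.
split=> [|j].
  split=> [z _|i]; first exact: continuous_quad_test.
  by split=> z _; [have [] := partial_quad_test i z|exact: continuous_partial_quad_test].
split=> [z _|i]; first exact: continuous_partial_quad_test.
split=> z _; first by have [] := partial2_quad_test i j z.
rewrite (_ : partial i _ = cst (2 * delta * (i == j)%:R - beta * (e ord0 i * e ord0 j))).
  exact: cst_continuous.
by apply/funext => y; have [] := partial2_quad_test i j y.
Qed.

Lemma gradient_quad_test z :
  gradient phi z = b - (beta * dotv e (z - x)) *: e + (2 * delta) *: (z - x).
Proof.
apply/rowP => i; rewrite !mxE; have [_ ->] := partial_quad_test i z.
by rewrite !mxE; ring.
Qed.

Lemma hessian_quad_test z :
  hessian phi z = - (beta *: (e^T *m e)) + (2 * delta)%:M.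
Proof.
apply/matrixP => i j; rewrite !mxE; have [_ ->] := partial2_quad_test i j z.
by rewrite big_ord_recl big_ord0 !mxE addr0 mulr_natr addrC.
Qed.

End quadratic_test.

(** * Compactness and ellipticity for the barrier *)

Section barrier.
Context {R : realType} {n : nat}.
Implicit Types p q x y z b e : 'rV[R]_n.

Lemma closed_le_continuous (T : topologicalType) (f : T -> R) (a : R) :
  continuous f -> closed [set t | f t <= a].
Proof.
move=> cf; rewrite (_ : mkset _ = f @^-1` [set r | r <= a])//.
by apply: closed_comp => // t _; exact: cf.
Qed.

Lemma closed_ge_continuous (T : topologicalType) (f : T -> R) (a : R) :
  continuous f -> closed [set t | a <= f t].
Proof.
move=> cf; rewrite (_ : mkset _ = f @^-1` [set r | a <= r])//.
by apply: closed_comp => // t _; exact: cf.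
Qed.

Lemma compact_eball x r : compact [set z | enorm (z - x) <= r].
Proof.
apply: bounded_closed_compact; last first.
  by apply: closed_le_continuous; apply: continuous_enorm; exact: continuous_subv.
exists (r + `|x|); split; first exact: num_real.
move=> M rM z /= zr; rewrite -[z](subrK x).
apply: (le_trans (ler_normD (z - x) x)); apply: le_trans (ltW rM).
by rewrite lerD2r (le_trans (norm_le_enorm _)).
Qed.

Lemma SymE (M : 'M[R]_n) : Sym M <-> M^T = M.
Proof.
rewrite /Sym/=; split => [/is_hermitianmxP|] MT.
  by rewrite {2}MT expr0 scale1r map_mx_id.
by apply/is_hermitianmxP; rewrite expr0 scale1r map_mx_id.
Qed.

Lemma mulmx_outer (v : 'rV[R]_n) e : v *m (e^T *m e) = dotv v e *: e.
Proof.
rewrite mulmxA; apply/rowP => i; rewrite !mxE big_ord_recl big_ord0 addr0 mxE.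
by congr (_ * _); apply: eq_bigr => j _; rewrite mxE.
Qed.

Lemma mxtrace_outer e : \tr (e^T *m e) = dotv e e.
Proof.
rewrite /mxtrace; apply: eq_bigr => i _.
by rewrite mxE big_ord_recl big_ord0 addr0 mxE.
Qed.

(** Ellipticity is used twice: [F] grows by at least [lambda * beta] from
    [- beta e e^T] to 0, where it vanishes, and adding the small convex part raises
    it by at most [Lambda] times the trace. For small [delta] the first effect wins. *)
Lemma elliptic_barrier_le (lambda Lambda beta delta : R) (F : 'M[R]_n -> R) e :
  elliptic_operator lambda Lambda F -> 0 <= beta -> 0 <= delta -> dotv e e = 1 ->
  F (- (beta *: (e^T *m e)) + (2 * delta)%:M) <=
    - (lambda * beta) + Lambda * (2 * delta *+ n).
Proof.
move=> [_ _ F0 ell] b0 d0 e1.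
have sN : Sym (beta *: (e^T *m e)).
  by apply/SymE; rewrite linearZ/= trmx_mul trmxK.
have pN : psd (beta *: (e^T *m e)).
  move=> v; rewrite -scalemxAr mulmx_outer !dotvZl (dotvC e) mulr_ge0//.
  by rewrite -expr2 sqr_ge0.
have sD : Sym ((2 * delta)%:M : 'M[R]_n).
  by apply/SymE; rewrite tr_scalar_mx.
have pD : psd ((2 * delta)%:M : 'M[R]_n).
  by move=> v; rewrite mul_mx_scalar dotvZl mulr_ge0 ?dotvv_ge0// mulr_ge0.
have sNN : Sym (- (beta *: (e^T *m e))).
  by apply/SymE; rewrite linearN/= (SymE _).1.
have /andP[+ _] := ell _ _ sNN sN pN.
rewrite addNr F0 mxtraceZ mxtrace_outer e1 mulr1 => H1.
have /andP[_ +] := ell _ _ sNN sD pD.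
by rewrite mxtrace_scalar => H2; lra.
Qed.

End barrier.

(** * Slopes at neighbouring contact points *)

Section gap.
Context {R : realType} {n : nat}.
Implicit Types p q x y z b e : 'rV[R]_n.

(** Write [g = |p - q|], [e = (p - q) / g] and [t = e . (z - x)]. Relative to the
    plane through [x], [u] is at most [min 0 (g (s - t))]. The barrier is this plane
    plus [- g t / 8 - g t^2 / (16 s) + delta |z - x|^2]: it meets [u] at [x], and on
    the boundary of the slab [- s <= t <= 2 s] cut at radius [rho] it is strictly
    above [u]. So [u] minus the barrier has an interior maximum, and the equation
    is tested there. The coefficient of [t^2] has size [g / s], which gives the
    bound on [g]; [delta] has to be a small multiple of [lambda / Lambda], which
    is paid only by the radius [rho]. *)
Lemma contact_slope_gap (lambda Lambda : R) (F : 'M[R]_n -> R)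
    (Phi : 'rV[R]_n -> R -> R) (f u : 'rV[R]_n -> R) (U : set 'rV[R]_n)
    x y p q (s : R) :
  (0 < n)%N -> elliptic_operator lambda Lambda F ->
  (forall z t, U z -> 0 <= t -> 0 <= Phi z t) ->
  viscosity_subsolution Phi F f U u -> {within U, continuous u} ->
  0 < s -> enorm (x - y) <= s -> 0 < enorm (p - q) ->
  (forall z, enorm (z - x) <= 32 * n%:R * (Lambda / lambda) * s -> U z) ->
  U y ->
  (forall z, U z -> u z <= u x + dotv p (z - x)) ->
  (forall z, U z -> u z <= u y + dotv q (z - y)) ->
  exists z P, [/\ enorm (z - x) <= 32 * n%:R * (Lambda / lambda) * s,
    enorm (P - p) <= 3 * enorm (p - q) &
    lambda * enorm (p - q) / (16 * s) * Phi z (enorm P) <= - f z].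
Proof.
move=> n0 ell Phi0 [_ sub] cu s0 xys g0 rhoU Uy xp yq.
have [/andP[l0 lL] _ _ _] := ell.
have L0 : 0 < Lambda by exact: lt_le_trans lL.
set g := enorm (p - q) in g0 *; set rho := 32 * _ * _ * _ in rhoU *.
have n0R : 0 < n%:R :> R by rewrite ltr0n.
pose e := g^-1 *: (p - q).
have ee : dotv e e = 1.
  by rewrite dotvZl dotvZr -sqr_enorm -/g; field; rewrite gt_eqF.
have ne : enorm e = 1 by rewrite /enorm ee sqrtr1.
have pqE z : dotv (p - q) z = g * dotv e z by rewrite dotvZl mulVKf ?gt_eqF.
clearbody e.
(* [delta] makes Lambda times the trace of the convex part half of lambda * beta *)
pose beta := g / (8 * s); pose delta := lambda * beta / (4 * Lambda * n%:R).
have beta0 : 0 < beta by rewrite divr_gt0 ?mulr_gt0.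
have delta0 : 0 < delta by rewrite /delta; apply: divr_gt0; do ?apply: mulr_gt0 => //.
have bs : beta * s = g / 8 by rewrite /beta; field; rewrite gt_eqF.
have drho : delta * rho = g.
  by rewrite /delta /rho /beta; field; rewrite !gt_eqF.
have rho_s : 32 * s <= rho.
  have H1 : 1 <= Lambda / lambda by rewrite ler_pdivlMr// mul1r.
  have H2 : (1 : R) <= n%:R by rewrite ler1n.
  rewrite /rho ler_pM2r// -mulrA ler_peMr//.
  by rewrite -[leLHS](mulr1 1); apply: ler_pM.
have rho0 : 0 < rho by apply: lt_le_trans rho_s; rewrite mulr_gt0.
pose phi := quad_test (u x) x (p - (g / 8) *: e) e beta delta.
have phiE z : phi z = u x + dotv p (z - x) - g / 8 * dotv e (z - x)
    - beta / 2 * dotv e (z - x) ^+ 2 + delta * enorm (z - x) ^+ 2.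
  by rewrite /phi /quad_test sqr_enorm (dotvBl p) (dotvZl (g / 8)); ring.
pose D := [set z | enorm (z - x) <= rho] `&`
  ([set z | - s <= dotv e (z - x)] `&` [set z | dotv e (z - x) <= 2 * s]).
have DU : D `<=` U by move=> z [/rhoU].
have cD : compact D.
  apply: compact_closedI; first exact: compact_eball.
  by apply: closedI; [apply: closed_ge_continuous|apply: closed_le_continuous];
    exact: continuous_dotv_sub.
have Dx : D x.
  by rewrite /D/= subrr enorm0 dotvC dot0v; split; [exact: ltW|split; lra].
have cuphi : {within D, continuous (u - phi)}.
  move=> z; apply: (@continuousB _ R^o (subspace D) u phi z).
    exact: (continuous_subspaceW DU cu).
  exact: (continuous_subspaceT (@continuous_quad_test _ _ _ _ _ _ _ _)).
have [z0 /set_mem Dz0 maxz0] := compact_EVT_max (ex_intro _ x Dx) cD cuphi.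
have w_ge : u x - phi x <= u z0 - phi z0 := maxz0 x (mem_set Dx).
rewrite !phiE subrr enorm0 !(dotvC _ 0) !dot0v in w_ge.
have := Dz0; rewrite /D/= => -[r_le [t_ge t_le]].
have w_le0 := xp _ (DU _ Dz0).
have w_le : u z0 <= u x + dotv p (z0 - x) + g * s - g * dotv e (z0 - x).
  have H1 := yq _ (DU _ Dz0).
  have H2 := xp _ Uy.
  have H3 : dotv (q - p) (x - y) <= g * s.
    apply: le_trans (dotv_le _ _) _.
    by rewrite enormB -/g ler_pM2l.
  have H4 := pqE (z0 - x).
  have H5 : dotv q (z0 - y) = dotv q (z0 - x) + dotv q (x - y).
    by rewrite -dotvDr; congr dotv; rewrite addrA subrK.
  have H6 : dotv p (y - x) = - dotv p (x - y) by rewrite -opprB dotvC dotvNl dotvC.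
  rewrite !dotvBl in H3 H4 *; lra.
have r_ge := enorm_ge0 (z0 - x).
have t2 : dotv e (z0 - x) ^+ 2 <= (2 * s) ^+ 2.
  rewrite -ler_sqrt ?sqr_ge0// !sqrtr_sqr ler_norml.
  by rewrite !ger0_norm ?mulr_ge0 ?(ltW s0)//; apply/andP; split; lra.
move: t_ge t_le w_ge w_le w_le0 r_le r_ge t2.
move tE : (dotv e (z0 - x)) => t; move rE : (enorm (z0 - x)) => r.
move=> t_ge t_le w_ge w_le w_le0 r_le r_ge t2.
have bt2 : beta / 2 * t ^+ 2 <= g * s / 4.
  have H : beta / 2 * t ^+ 2 <= beta / 2 * (2 * s) ^+ 2.
    by rewrite ler_wpM2l// divr_ge0// ltW.
  have -> : g * s / 4 = beta * s * s * 2 by rewrite bs; field.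
  by apply: le_trans H _; rewrite le_eqVlt; apply/orP; left; apply/eqP; field.
have gs0 : 0 < g * s by rewrite mulr_gt0.
have dr0 : 0 <= delta * r ^+ 2 by rewrite mulr_ge0 ?sqr_ge0// ltW.
(* the maximum avoids the face t = - s, where the barrier is above the plane at x *)
have t_gt : - s < t.
  rewrite lt_neqAle t_ge andbT; apply/eqP => st.
  have Hb : beta / 2 * t ^+ 2 = g * s / 16.
    by rewrite -st; have -> : g * s / 16 = beta * s * s / 2 by [rewrite bs; field]; field.
  move: w_ge; rewrite Hb -st. lra.
have gt_le : g * t <= g * (2 * s) by rewrite ler_pM2l.
(* it avoids the face t = 2 s, where the plane at y is far below the barrier *)
have t_lt : t < 2 * s.
  rewrite lt_neqAle t_le andbT; apply/eqP => st.
  have H : g * t = g * (2 * s) by rewrite st.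
  by lra.
(* it avoids the lateral face, where the convex part outweighs the other terms *)
have r_lt : r < rho.
  rewrite lt_neqAle r_le andbT; apply/eqP => st.
  have H : delta * r ^+ 2 = g * rho by rewrite st expr2 mulrA drho.
  have H2 : g * (32 * s) <= g * rho by rewrite ler_pM2l.
  by move: w_ge w_le0; rewrite H; lra.
have lmax : local_max (u - phi) z0.
  rewrite /local_max.
  have c1 := @continuous_enorm _ _ _ _ (@continuous_subv _ _ x) z0.
  have c2 := @continuous_dotv_sub _ _ e x z0.
  near=> z; apply: maxz0; apply/mem_set; split; last split; rewrite /=; apply: ltW.
  - by near: z; apply: (cvgr_lt _ c1); rewrite rE.
  - by near: z; apply: (cvgr_gt _ c2); rewrite tE.
  - by near: z; apply: (cvgr_lt _ c2); rewrite tE.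
have := sub phi z0 (C2_on_quad_test _ _ _ _ _ _ _) (DU _ Dz0) lmax.
rewrite hessian_quad_test; set P := gradient phi z0 => visc.
exists z0, P; split=> //; first by rewrite rE.
  rewrite /P gradient_quad_test tE.
  have -> : p - (g / 8) *: e - (beta * t) *: e + (2 * delta) *: (z0 - x) - p =
      - ((g / 8 + beta * t) *: e) + (2 * delta) *: (z0 - x).
    by apply/rowP => i; rewrite !mxE; ring.
  apply: le_trans (enormD _ _) _; rewrite enormN !enormZ ne rE mulr1.
  have b_s : `|g / 8 + beta * t| <= g / 2.
    have := ler_wpM2l (ltW beta0) t_ge; have := ler_wpM2l (ltW beta0) t_le.
    by rewrite ler_norml => A B; apply/andP; split; lra.
  have : `|2 * delta| * r <= 2 * g.
    rewrite ger0_norm; last by apply: mulr_ge0 => //; exact: ltW.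
    by rewrite -mulrA ler_pM2l// -drho ler_pM2l.
  by lra.
have /= Fle := elliptic_barrier_le ell (ltW beta0) (ltW delta0) ee.
have Phi0' := Phi0 z0 (enorm P) (DU _ Dz0) (enorm_ge0 _).
have Fle' : F (- (beta *: (e^T *m e)) + (2 * delta)%:M) <= - (lambda * g / (16 * s)).
  apply: le_trans Fle _; rewrite -mulr_natr le_eqVlt; apply/orP; left; apply/eqP.
  by rewrite /delta /beta; field; rewrite !gt_eqF.
have := ler_wpM2l Phi0' Fle'.
by move=> H; rewrite (mulrC _ (Phi _ _)); lra.
Unshelve. all: by end_near. Qed.

End gap.

(** * Lebesgue measure of boxes and open sets *)

Section rV_measure.
Context {R : realType}.

Lemma measurable_rV_prod n (B : 'I_n -> set R) :
  (forall i, measurable (B i)) ->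
  measurable [set v : 'rV[R]_n | forall i, B i (v ord0 i)].
Proof.
move=> mB.
have -> : [set v : 'rV[R]_n | forall i, B i (v ord0 i)] =
    \bigcap_(i in [set: 'I_n]) (rV_coord i @^-1` B i).
  by apply/seteqP; split => v H i //=; exact: H.
apply: fin_bigcap_measurable => // i _.
by rewrite -[X in measurable X]setTI; apply: measurable_rV_coord => //; exact: mB.
Qed.

(** The booleans select open or closed faces in the convention of interval bounds:
    [true] [true] gives the half-open cells of a partition, [true] [false] closed
    boxes and [false] [true] open ones. *)
Definition rV_itv n (l r : bool) (a b : 'rV[R]_n) : set 'rV[R]_n :=
  [set v | forall i, v ord0 i \in Interval (BSide l (a ord0 i)) (BSide r (b ord0 i))].

Lemma measurable_rV_itv n l r (a b : 'rV[R]_n) : measurable (rV_itv l r a b).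
Proof.
apply: (@measurable_rV_prod _ (fun i =>
  [set` Interval (BSide l (a ord0 i)) (BSide r (b ord0 i))])) => i.
exact: measurable_itv.
Qed.

Lemma lebesgue_rV_itv n l r (a b : 'rV[R]_n) :
  (forall i, a ord0 i < b ord0 i) ->
  lebesgue_rV R n (rV_itv l r a b) = (\prod_(i < n) (b ord0 i - a ord0 i))%:E.
Proof.
elim: n a b => [|n IHn] a b ab.
  rewrite big_ord0 /= diracE mem_set// => -[].
  by case.
pose a' : 'rV[R]_n := \row_j a ord0 (lift ord0 j).
pose b' : 'rV[R]_n := \row_j b ord0 (lift ord0 j).
rewrite big_ord_recl EFinM /= /lebesgue_rV_cons /pushforward.
have -> : rV_cons @^-1` rV_itv l r a b =
    [set` Interval (BSide l (a ord0 ord0)) (BSide r (b ord0 ord0))] `*`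
    rV_itv l r a' b'.
  apply/seteqP; split => [[x v]/= H|[x v] /= [H0 H] i].
    split; first by have := H ord0; rewrite mxE unlift_none.
    by move=> i; have := H (lift ord0 i); rewrite !mxE liftK.
  rewrite mxE; case: unliftP => [j ->|->] //=.
  by have := H j; rewrite !mxE.
rewrite product_measure1E//=; last exact: measurable_rV_itv.
rewrite lebesgue_measure_itv /= lte_fin ab IHn; last by move=> i; rewrite !mxE; exact: ab.
by congr (_ * _)%E; congr EFin; apply: eq_bigr => i _; rewrite !mxE.
Qed.

(** The sigma-algebra is generated by the coordinates, so open sets have to be
    written as countable unions of boxes; rational corners do it. *)
Lemma measurable_rV_open n (U : set 'rV[R]_n) : open U -> measurable U.
Proof.
move=> oU.
pose B (k : {ffun 'I_n -> rat} * {ffun 'I_n -> rat}) :=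
  rV_itv false true (\row_i (ratr (k.1 i) : R)) (\row_i (ratr (k.2 i) : R)).
have -> : U = \bigcup_k (if `[< B k `<=` U >] then B k else set0).
  apply/seteqP; split => [x Ux|x [k _]]; last by case: asboolP => // + Bx; exact.
  have /nbhs_ballP[e /= e0 eU] : nbhs x U by exact: open_nbhs_nbhs.
  have /choice[a Ha] (i : 'I_n) : exists q : rat, x ord0 i - e < ratr q < x ord0 i.
    have [q] : exists q : rat, ratr q \in `]x ord0 i - e, x ord0 i[.
      by apply: rat_in_itvoo; rewrite ltrBlDr ltrDl.
    by rewrite in_itv/=; exists q.
  have /choice[b Hb] (i : 'I_n) : exists q : rat, x ord0 i < ratr q < x ord0 i + e.
    have [q] : exists q : rat, ratr q \in `]x ord0 i, x ord0 i + e[.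
      by apply: rat_in_itvoo; rewrite ltrDl.
    by rewrite in_itv/=; exists q.
  exists ([ffun i => a i], [ffun i => b i]) => //.
  case: asboolP => [_ i|[]].
    rewrite !mxE !ffunE in_itv/=.
    by have /andP[_ ->] := Ha i; have /andP[->] := Hb i.
  move=> v Bv; apply: eU; split => // i j; rewrite ord1.
  have := Bv j; rewrite !mxE !ffunE in_itv/= => /andP[av vb].
  have /andP[xa _] := Ha j; have /andP[_ bx] := Hb j.
  by rewrite /ball/= ltr_norml; apply/andP; split; lra.
apply: countable_bigcupT_measurable; first exact: countableP.
by move=> k; case: ifP => // _; exact: measurable_rV_itv.
Qed.

Lemma measure_bigsetU_le d (T : measurableType d) (mu : {measure set T -> \bar R})
    (I : Type) (s : seq I) (F : I -> set T) :
  (forall i, measurable (F i)) ->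
  (mu (\big[setU/set0]_(i <- s) F i) <= \sum_(i <- s) mu (F i))%E.
Proof.
move=> mF; elim: s => [|i s IH]; first by rewrite !big_nil measure0.
rewrite !big_cons; apply: le_trans (measureU2 _ _ _) _ => //.
  by apply: bigsetU_measurable.
by rewrite leeD2l.
Qed.

End rV_measure.

(** * Covering a set of slopes *)

Section covering.
Context {R : realType}.

(** A substitute for the change of variables p = Du(x): [S x p] says that the
    slope [p] occurs at [x], and is allowed to be multivalued. In a cell of side [r]
    all slopes lie in a box of half-side [r * h x], for any [x] of the cell where a
    slope occurs; the volume of the box is [2 ^ n h(x)^n] times that of the cell,
    and [H] majorizes [h(x)^n] on the whole cell. Only cells in which some slope
    occurs are used, and they are disjoint and contained in [V]. *)
Lemma slope_covering n (A V Pi : set 'rV[R]_n) (S : 'rV[R]_n -> 'rV[R]_n -> Prop)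
    (h H : 'rV[R]_n -> R) (r M : R) :
  0 < r -> (forall (x : 'rV[R]_n) i, A x -> `|x ord0 i| <= M) ->
  measurable V -> measurable_fun V (fun z => (H z)%:E) ->
  (forall z, V z -> 0 <= H z) -> measurable Pi ->
  (forall p, Pi p -> exists2 x, A x & S x p) ->
  (forall x, A x -> 0 < h x) ->
  (forall x z : 'rV[R]_n, A x -> (forall i, `|z ord0 i - x ord0 i| <= r) ->
     V z /\ h x ^+ n <= H z) ->
  (forall x y p q : 'rV[R]_n, A x -> A y -> S x p -> S y q ->
     (forall i, `|x ord0 i - y ord0 i| <= r) ->
     forall i, `|p ord0 i - q ord0 i| <= r * h x) ->
  (lebesgue_rV R n Pi <= (2 ^+ n)%:E * \int[lebesgue_rV R n]_(z in V) (H z)%:E)%E.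
Proof.
move=> r0 AM mV mH H0 mPi PiA h0 hH Sh.
have [->|/set0P[p0 Pip0]] := eqVneq Pi set0.
  by rewrite measure0 mule_ge0// ?lee_fin ?exprn_ge0// integral_ge0// => z Vz; rewrite lee_fin H0.
have [x0 Ax0 _] := PiA _ Pip0.
(* m'.+1 cells of side r in each direction cover the interval [- M, M] *)
pose m' := Num.truncn (2 * M / r).
pose K : finType := {ffun 'I_n -> 'I_m'.+1}.
pose low (k : K) : 'rV[R]_n := \row_i (- M + r * (k i)%:R).
pose upp (k : K) : 'rV[R]_n := \row_i (- M + r * (k i)%:R + r).
pose cell (k : K) := rV_itv true true (low k) (upp k).
have floorE (a : R) (k : nat) :
    (k%:R <= a / r < k.+1%:R) = (r * k%:R <= a < r * k%:R + r).
  rewrite ler_pdivlMr// ltr_pdivrMr// -(natr1 k) (mulrDl k%:R 1 r) mul1r.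
  by rewrite (mulrC k%:R r).
have cellE k v : cell k v ->
    forall i, (k i)%:R <= (v ord0 i + M) / r < (k i).+1%:R.
  move=> /[swap] i /(_ i); rewrite !mxE in_itv/= => /andP[lv vu].
  by rewrite floorE; apply/andP; split; lra.
have cell_dist k v w : cell k v -> cell k w -> forall i, `|v ord0 i - w ord0 i| <= r.
  move=> kv kw i; have := kv i; have := kw i; rewrite !mxE !in_itv/=.
  by move=> /andP[? ?] /andP[? ?]; rewrite ler_norml; apply/andP; split; lra.
have cell_ex x : A x -> exists k, cell k x.
  move=> Ax; exists [ffun i => inord (Num.truncn ((x ord0 i + M) / r))] => i.
  have := AM x i Ax; rewrite ler_norml => /andP[Mx xM].
  have q0 : 0 <= (x ord0 i + M) / r by apply: divr_ge0; [lra|exact: ltW].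
  have qm : (Num.truncn ((x ord0 i + M) / r) < m'.+1)%N.
    rewrite truncn_lt_nat//; apply: le_lt_trans (truncnS_gt _).
    by rewrite ler_pM2r ?invr_gt0//; lra.
  rewrite !mxE ffunE inordK// in_itv/=.
  have := truncn_itv q0; rewrite floorE => /andP[? ?].
  by apply/andP; split; lra.
have cell_triv (s : seq K) : trivIset [set` s] cell.
  move=> k k' _ _ [v [kv k'v]]; apply/ffunP => i; apply/val_inj => /=.
  by rewrite -(truncn_def (cellE _ _ kv i)) (truncn_def (cellE _ _ k'v i)).
pose T k := `[< exists x p, [/\ A x, cell k x & S x p] >].
have /choice[xp xpP] (k : K) : exists xp : 'rV[R]_n * 'rV[R]_n,
    T k -> [/\ A xp.1, cell k xp.1 & S xp.1 xp.2].
  have [/asboolP[x [p xpk]]|Tk] := boolP (T k); last by exists (0, 0).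
  by exists (x, p).
pose s := [seq k <- enum K | T k].
have sT k : k \in s -> T k by rewrite mem_filter => /andP[].
pose w k := r * h (xp k).1.
pose Rk k := rV_itv true false (\row_i ((xp k).2 ord0 i - w k))
                               (\row_i ((xp k).2 ord0 i + w k)).
have PiR : Pi `<=` \big[setU/set0]_(k <- s) Rk k.
  move=> p Pip; rewrite -bigcup_seq.
  have [x Ax Sxp] := PiA _ Pip; have [k kx] := cell_ex _ Ax.
  have Tk : T k by apply/asboolP; exists x, p.
  exists k; first by rewrite /= mem_filter Tk mem_enum.
  have [Ak kk Sk] := xpP _ Tk.
  move=> i; rewrite !mxE in_itv/=.
  have := Sh _ _ _ _ Ak Ax Sk Sxp (cell_dist _ _ _ kk kx) i.
  by rewrite ler_norml /w => /andP[? ?]; apply/andP; split; lra.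
have mR k : measurable (Rk k) by exact: measurable_rV_itv.
have mc k : measurable (cell k) by exact: measurable_rV_itv.
have cellV k : k \in s -> cell k `<=` V.
  move=> /sT Tk z kz; have [Ak kk _] := xpP _ Tk.
  by have [] := hH _ z Ak (cell_dist _ _ _ kz kk).
have unionV : \big[setU/set0]_(k <- s) cell k `<=` V.
  by rewrite -bigcup_seq => z [k /= ks kz]; exact: cellV kz.
have mU : measurable (\big[setU/set0]_(k <- s) cell k) by exact: bigsetU_measurable.
apply: le_trans (le_measure _ _ _ PiR) _; rewrite ?inE//.
  exact: bigsetU_measurable.
apply: le_trans (measure_bigsetU_le _ _ mR) _.
apply: (@le_trans _ _ ((2 ^+ n)%:E *
    \int[lebesgue_rV R n]_(z in \big[setU/set0]_(k <- s) cell k) (H z)%:E)%E);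
  last first.
  apply: lee_wpmul2l; first by rewrite lee_fin exprn_ge0.
  by apply: ge0_subset_integral => // z /H0; rewrite lee_fin.
rewrite ge0_integral_bigsetU//; last 3 first.
- by rewrite filter_uniq// enum_uniq.
- exact: measurable_funS mH.
- by move=> z /unionV/H0; rewrite lee_fin.
rewrite big_seq [in leRHS]big_seq ge0_sume_distrr; last first.
  move=> k ks; apply: integral_ge0 => z /(cellV _ ks) /H0.
  by rewrite lee_fin.
apply: lee_sum => k ks; have [Ak kk _] := xpP _ (sT _ ks).
have prodE (a : R) : \prod_(i < n) a = a ^+ n by rewrite prodr_const card_ord.
have w0 : 0 < w k by rewrite mulr_gt0 ?h0.
rewrite -[leLHS]/(lebesgue_rV R n (Rk k)).
have -> : lebesgue_rV R n (Rk k) = (2 ^+ n * h (xp k).1 ^+ n * r ^+ n)%:E.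
  rewrite lebesgue_rV_itv; last by move=> i; rewrite !mxE; lra.
  congr EFin; rewrite -!exprMn -prodE; apply: eq_bigr => i _.
  by rewrite !mxE /w; ring.
rewrite -mulrA EFinM; apply: lee_wpmul2l; first by rewrite lee_fin exprn_ge0.
have -> : ((h (xp k).1 ^+ n * r ^+ n)%:E =
    \int[lebesgue_rV R n]_(z in cell k) cst (h (xp k).1 ^+ n)%:E z)%E.
  rewrite integral_cst// EFinM -[X in (_ = _ * X)%E]/(lebesgue_rV R n (cell k)).
  rewrite lebesgue_rV_itv; last by move=> i; rewrite !mxE ltrDl.
  congr (_ * _)%E; congr EFin; rewrite -prodE.
  by apply: eq_bigr => i _; rewrite !mxE; ring.
apply: ge0_le_integral => //.
- by move=> z _; rewrite lee_fin exprn_ge0// ltW// h0.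
- by apply: measurable_funS mH => //; exact: cellV.
- move=> z kz; rewrite lee_fin.
  by have [] := hH _ z Ak (cell_dist _ _ _ kz kk).
Qed.

End covering.

(** * Compact sets of contact points *)

Section contact.
Context {R : realType} {n : nat}.

(** If no slope of [Pi] is in contact at a limit point [x], each slope is refuted
    by some [y], and the refutation persists for nearby slopes and nearby points.
    Compactness of [Pi] makes the neighbourhood of [x] uniform in the slope. *)
Lemma compact_contact_set (K Pi : set 'rV[R]_n) (u : 'rV[R]_n -> R) :
  compact K -> compact Pi -> {within K, continuous u} ->
  compact [set x | K x /\ exists2 p, Pi p &
                   forall y, K y -> u y <= u x + dotv p (y - x)].
Proof.
move=> cK cPi cu; set A := mkset _.
apply: (subclosed_compact _ cK); last by move=> x [].
move=> x clAx.
have Kx : K x.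
  have : closure K x by apply: closure_subset clAx => y [].
  by apply: compact_closed => //; exact: norm_hausdorff.
apply: contrapT => nAx.
have {}nAx p : Pi p -> exists2 y, K y & u x + dotv p (y - x) < u y.
  move=> Pip; apply: contrapT => H; apply: nAx; split=> //; exists p => // y Ky.
  by rewrite leNgt; apply/negP => uy; apply: H; exists y.
have cux := (subspace_continuousP _ _).1 cu x Kx.
have : \forall x' \near within K (nbhs x), Pi `<=`
    (fun p => exists2 y, K y & u x' + dotv p (y - x') < u y).
  apply: ((compact_near_coveringP Pi).1 cPi _ (within K (nbhs x))
    (fun x' p => exists2 y, K y & u x' + dotv p (y - x') < u y)) => p Pip.
  have [y Ky uy] := nAx p Pip.
  pose d := (u y - (u x + dotv p (y - x))) / 2.
  have d0 : 0 < d by rewrite divr_gt0// subr_gt0.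
  have /(_ (p, x)) cd : continuous (fun t : 'rV[R]_n * 'rV[R]_n => dotv t.1 (y - t.2)).
    apply: continuous_dotv; first by move=> t; exact: cvg_fst.
    move=> t; exact: (@cvgB _ 'rV[R]_n _ (nbhs t) _ _ _ _ _ (cvg_cst y) (@cvg_snd _ _ _ _ _)).
  have [[P1 P2]/= [nP1 nP2] HP] : \forall t \near (p, x),
      dotv t.1 (y - t.2) < dotv p (y - x) + d.
    by apply: (cvgr_lt _ cd); rewrite /= ltrDl.
  have nu : \forall x' \near within K (nbhs x), u x' < u x + d.
    by apply: (cvgr_lt _ cux); rewrite ltrDl.
  exists (P1, P2 `&` [set x' | u x' < u x + d]).
    by split => //=; apply: filterI => //; exact: (filterS (fun _ h _ => h) nP2).
  move=> [p' x'] /= [P1p [P2x ux']]; exists y => //.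
  have := HP (p', x') (conj P1p P2x); rewrite /= /d => H.
  by move: ux'; rewrite /d => H'; lra.
move=> /clAx [x' [[Kx' [p Pip px']]]] /(_ Kx' p Pip)[y Ky].
by rewrite ltNge px'.
Qed.

Lemma compact_uniform_nbhd (A O : set 'rV[R]_n) (f : 'rV[R]_n -> R) (tau : R) :
  compact A -> open O -> A `<=` O -> {in O, continuous f} -> 0 < tau ->
  exists2 eta, 0 < eta & forall a z : 'rV[R]_n, A a -> `|z - a| < eta ->
    O z /\ `|f z - f a| < tau.
Proof.
move=> cA oO AO cf tau0.
have : \forall eta \near (0 : R)^'+, A `<=`
    (fun a => forall z, `|z - a| < eta -> O z /\ `|f z - f a| < tau).
  apply: ((compact_near_coveringP A).1 cA _ _
    (fun eta a => forall z, `|z - a| < eta -> O z /\ `|f z - f a| < tau)) => a Aa.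
  have Oa := AO _ Aa.
  have [e /= e0 He] : exists2 e, 0 < e & forall z, ball a e z -> O z /\ `|f a - f z| < tau / 2.
    have : nbhs a (O `&` [set z | `|f a - f z| < tau / 2]).
      apply: filterI; first exact: open_nbhs_nbhs.
      have := cf a (mem_set Oa); move/cvgr_dist_lt; apply; exact: divr_gt0.
    by move=> /nbhs_ballP[e e0 He]; exists e.
  exists (ball a (e / 2), [set eta | eta < e / 2]).
    split; first by apply: nbhsx_ballx; exact: divr_gt0.
    by apply: nbhs_right_lt; exact: divr_gt0.
  move=> [a' eta] /= [aa' etae] z za'.
  have e20 : 0 < e / 2 by exact: divr_gt0.
  have [Oa' fa'] : O a' /\ `|f a - f a'| < tau / 2.
    by apply: He; apply: le_ball aa'; lra.
  have [Oz fz] : O z /\ `|f a - f z| < tau / 2.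
    apply: He; apply: (@ball_split _ _ a'); first by [].
    by rewrite -ball_normE /ball_/= distrC; lra.
  split => //; rewrite distrC.
  have -> : f a' - f z = (f a' - f a) + (f a - f z) by ring.
  by apply: (le_lt_trans (ler_normD _ _)); rewrite (distrC (f a')); lra.
move=> [eta /= eta0 H]; exists (eta / 2); first exact: divr_gt0.
move=> a z Aa za; apply: (H (eta / 2) _ _ a Aa z za).
  by rewrite /ball_/= sub0r normrN gtr0_norm ?divr_gt0//; rewrite /= in eta0; lra.
exact: divr_gt0.
Qed.

End contact.

(** * Integrals over shrinking neighbourhoods *)

Section integral_nbhd.
Context {R : realType} {n : nat}.

Lemma measurable_fun_continuous_open (D : set 'rV[R]_n) (g : 'rV[R]_n -> R) :
  open D -> {in D, continuous g} -> measurable_fun D g.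
Proof.
move=> oD cg mD; apply: (measurability _ (RGenOpens.measurableE R)) => //.
move=> _ [_ [a [b ->] <-]]; apply: measurable_rV_open.
rewrite openE => x [Dx gx]; rewrite /interior; apply: filterI; first exact: open_nbhs_nbhs.
apply: (cg x (mem_set Dx)); apply: open_nbhs_nbhs; split=> //.
Qed.

Lemma exprD_le (a b : R) : 0 <= a -> 0 <= b ->
  (a + b) ^+ n <= 2 ^+ n * (a ^+ n + b ^+ n).
Proof.
wlog ab : a b / a <= b.
  move=> H a0 b0; have [ab|/ltW ba] := leP a b; first exact: H.
  by rewrite (addrC a) (addrC (a ^+ n)); exact: H.
move=> a0 b0; apply: (@le_trans _ _ ((2 * b) ^+ n)).
  by rewrite lerXn2r ?nnegrE ?addr_ge0 ?mulr_ge0//; lra.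
by rewrite exprMn ler_wpM2l ?exprn_ge0// lerDr exprn_ge0.
Qed.

Lemma compact_norm_le (A : set 'rV[R]_n) : compact A ->
  exists2 b, 0 < b & forall x, A x -> `|x| <= b.
Proof.
move=> /compact_bounded[b [_ Hb]]; exists (Num.max 1 (b + 1)).
  by rewrite lt_max ltr01.
by move=> x Ax; apply: Hb => //; rewrite lt_max ltrDl ltr01 orbT.
Qed.

Lemma lebesgue_rV_bounded_lty (A : set 'rV[R]_n) (b : R) : measurable A ->
  (forall x, A x -> `|x| <= b) -> (lebesgue_rV R n A < +oo)%E.
Proof.
move=> mA Ab.
have [->|/set0P[x0 Ax0]] := eqVneq A set0; first by rewrite measure0 ltry.
have b0 : 0 <= b by exact: le_trans (Ab _ Ax0).
pose B : set 'rV[R]_n := rV_itv true false (const_mx (- (b + 1))) (const_mx (b + 1)).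
have AB : A `<=` B.
  move=> x /Ab xb i; rewrite !mxE in_itv/= -ler_norml.
  by apply: (le_trans (coord_le_norm x i)); lra.
apply: (@le_lt_trans _ _ (lebesgue_rV R n B)).
  by apply: le_measure; rewrite ?inE//; exact: measurable_rV_itv.
by rewrite lebesgue_rV_itv ?ltry// => i; rewrite !mxE; lra.
Qed.

(** The error [2 * tau] absorbs the oscillation of [g] at distance [eta]. The
    neighbourhoods of [A] of radius [eta0 / k.+1] decrease to [A], so that their
    excess over [A] has small measure, and [g] is bounded on them. *)
Lemma integral_nbhd_le (A O : set 'rV[R]_n) (g : 'rV[R]_n -> R) (eps : R) :
  (0 < n)%N -> compact A -> open O -> A `<=` O -> {in O, continuous g} ->
  (forall x, 0 <= g x) -> 0 < eps ->
  exists tau eta (V : set 'rV[R]_n), [/\ 0 < tau, 0 < eta, open V /\ V `<=` O,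
    forall a z : 'rV[R]_n, A a -> `|z - a| < eta -> V z /\ `|g z - g a| < tau &
    (\int[lebesgue_rV R n]_(z in V) ((g z + 2 * tau) ^+ n)%:E <=
     (2 ^+ n)%:E * \int[lebesgue_rV R n]_(z in A) (g z ^+ n)%:E + eps%:E)%E].
Proof.
move=> n0 cA oO AO cg g0 eps0.
have clA : closed A by apply: compact_closed => //; exact: norm_hausdorff.
have mA : measurable A.
  by rewrite -(setCK A); apply: measurableC; apply: measurable_rV_open; exact: closed_openC.
have [b b0 Ab] := compact_norm_le cA.
have Afin := lebesgue_rV_bounded_lty mA Ab.
have [B B0 gB] : exists2 B, 0 <= B & forall a, A a -> g a <= B.
  have [->|/set0P A0] := eqVneq A set0; first by exists 0.
  have cgA : {within A, continuous g}.
    by apply: continuous_in_subspaceT => x /set_mem Ax; apply: cg; apply/mem_set/AO.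
  have [c /set_mem Ac Hc] := compact_EVT_max A0 cA cgA.
  by exists (g c) => // a Aa; apply: Hc; exact/mem_set.
pose m := fine (lebesgue_rV R n A).
have m0 : 0 <= m by apply: fine_ge0.
have mE : lebesgue_rV R n A = m%:E by rewrite fineK// ge0_fin_numE.
(* tau <= 1 gives (2 tau)^n <= 2^n tau, and the other bound makes 4^n tau m small *)
pose tau := Num.min 1 (eps / (2 * (4 ^+ n * (m + 1)))).
have C0 : 0 < 4 ^+ n * (m + 1) by rewrite mulr_gt0 ?exprn_gt0//; lra.
have tau0 : 0 < tau by rewrite lt_min ltr01/=; apply: divr_gt0 => //; exact: mulr_gt0.
have tau1 : tau <= 1 by rewrite ge_min lexx.
have tau_eps : 4 ^+ n * tau * m <= eps / 2.
  apply: (@le_trans _ _ (4 ^+ n * (m + 1) * tau)).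
    rewrite mulrAC ler_pM2r// ler_pM2l ?exprn_gt0//; lra.
  apply: (@le_trans _ _ (4 ^+ n * (m + 1) * (eps / (2 * (4 ^+ n * (m + 1)))))).
    by rewrite ler_pM2l// ge_min lexx orbT.
  by rewrite le_eqVlt; apply/orP; left; apply/eqP; field; rewrite gt_eqF//= ?exprn_gt0//; lra.
have [eta0 eta00 Heta0] := compact_uniform_nbhd cA oO AO cg tau0.
pose r k : R := eta0 / k.+1%:R.
have r0 k : 0 < r k by rewrite divr_gt0.
pose V k := \bigcup_(a in A) ball a (r k).
have oV k : open (V k) by apply: bigcup_open => a _; exact: ball_open.
have mV k : measurable (V k) by exact: measurable_rV_open.
have AV k : A `<=` V k by move=> a Aa; exists a => //; exact: ballxx.
have rle k l : (k <= l)%N -> r l <= r k.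
  by move=> kl; rewrite ler_pM2l// lef_pV2 ?posrE// ler_nat.
have VO k z : V k z -> exists a, [/\ A a, O z & `|g z - g a| < tau].
  move=> [a Aa za]; exists a.
  have [] := Heta0 a z Aa _; last by [].
  move: za; rewrite -ball_normE /ball_/= distrC => /lt_le_trans; apply.
  by apply: le_trans (rle 0%N k _) _ => //; rewrite /r divr1.
pose W k := V k `\` A.
have mW k : measurable (W k) by exact: measurableD.
have W0fin : (lebesgue_rV R n (W 0%N) < +oo)%E.
  apply: (@lebesgue_rV_bounded_lty _ (b + r 0%N)) => // x [[a Aa ax] _].
  move: ax; rewrite -ball_normE /ball_/= => ax.
  rewrite -[x](subrK a); apply: (le_trans (ler_normD (x - a) a)).
  by rewrite addrC lerD ?Ab// distrC ltW.
have W_ni : {homo W : k l / (k <= l)%N >-> (l <= k)%O}.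
  move=> k l kl; apply/subsetPset => x [[a Aa ax] nAx]; split => //; exists a => //.
  exact: le_ball (rle _ _ kl) _ ax.
have W_cap : \bigcap_k W k = set0.
  apply/seteqP; split => // x Wx.
  have [_ nAx] := Wx 0%N I; apply: nAx; apply: clA => U /nbhs_ballP[e /= e0 eU].
  have [k Hk] : exists k, r k < e.
    exists (Num.truncn (eta0 / e)); rewrite /r ltr_pdivrMr// mulrC -ltr_pdivrMr//.
    exact: truncnS_gt.
  have [[a Aa ax] _] := Wx k I; exists a; split => //; apply: eU.
  by apply: ball_sym; apply: le_ball (ltW Hk) _ ax.
have := nonincreasing_cvg_mu W0fin mW; rewrite W_cap measure0.
move=> /(_ measurable0 W_ni) /fine_cvg cvgW.
(* B + 3 bounds g + 2 tau on the neighbourhoods, since g <= B + tau there *)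
pose eps' := eps / (2 * (B + 3) ^+ n).
have B3 : 0 < (B + 3) ^+ n by rewrite exprn_gt0//; lra.
have eps'0 : 0 < eps' by rewrite divr_gt0 ?mulr_gt0.
have [k _ Hk] : \forall k \near \oo, fine (lebesgue_rV R n (W k)) < eps'.
  exact: (cvgr_lt _ cvgW).
have {}Hk := Hk k (leqnn k).
have Wk_fin : lebesgue_rV R n (W k) \is a fin_num.
  rewrite ge0_fin_numE//; apply: le_lt_trans W0fin; apply: le_measure; rewrite ?inE//.
  by apply/subsetPset; exact: W_ni.
exists tau, (r k), (V k); split => //.
- by split => // z /VO[a []].
- move=> a z Aa za; split.
    by exists a => //; rewrite -ball_normE /ball_/= distrC.
  have [] := Heta0 a z Aa _; last by [].
  by apply: lt_le_trans za _; apply: le_trans (rle 0%N k _) _ => //; rewrite /r divr1.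
have cgV : {in V k, continuous g}.
  by move=> x /set_mem /VO[a [_ Ox _]]; apply: cg; exact/mem_set.
have mg (c : R) : measurable_fun (V k) (fun z => ((g z + c) ^+ n)%:E).
  apply/measurable_EFinP; apply: measurable_funX.
  apply: measurable_funD; last exact: measurable_cst.
  exact: measurable_fun_continuous_open.
have gt0 (c : R) z : 0 <= c -> 0 <= (g z + c) ^+ n.
  by move=> c0; rewrite exprn_ge0// addr_ge0.
have t20 : 0 <= 2 * tau by lra.
rewrite -(setDUK (AV k)) ge0_integral_setU//; last 4 first.
- exact: mW.
- by rewrite setDUK.
- by move=> z _; rewrite lee_fin gt0.
- by apply/disj_set2P; rewrite setDE setIA setIC setIA setICl set0I.
have -> : eps%:E = ((eps / 2)%:E + (eps / 2)%:E)%E by rewrite -EFinD; congr EFin; field.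
have intA : (\int[lebesgue_rV R n]_(z in A) ((g z + 2 * tau) ^+ n)%:E <=
    (2 ^+ n)%:E * \int[lebesgue_rV R n]_(z in A) (g z ^+ n)%:E + (eps / 2)%:E)%E.
  apply: (@le_trans _ _ (\int[lebesgue_rV R n]_(z in A)
    ((2 ^+ n)%:E * (g z ^+ n)%:E + cst (4 ^+ n * tau)%:E z))%E).
    apply: ge0_le_integral => //.
    + by move=> z _; rewrite lee_fin gt0.
    + exact: measurable_funS (mg _).
    + apply: emeasurable_funD => //; apply: measurable_funeM.
      have := measurable_funS (mV k) (AV k) (mg 0).
      by under eq_fun do rewrite addr0.
    + move=> z _; rewrite -EFinM -EFinD lee_fin.
      apply: (le_trans (exprD_le (g0 z) t20)).
      rewrite mulrDr lerD2l -exprMn mulrA (_ : 2 * 2 = 4); last by ring.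
      rewrite exprMn ler_wpM2l ?exprn_ge0//.
      by rewrite -[leRHS]expr1; apply: ler_wiXn2l => //; exact: ltW.
  rewrite ge0_integralD//; last 3 first.
  + by move=> z _; rewrite -EFinM lee_fin mulr_ge0 ?exprn_ge0.
  + apply: measurable_funeM; have := measurable_funS (mV k) (AV k) (mg 0).
    by under eq_fun do rewrite addr0.
  + by move=> z _; rewrite lee_fin mulr_ge0 ?exprn_ge0// ltW.
  rewrite ge0_integralZl_EFin ?exprn_ge0//; last 2 first.
  + by move=> z _; rewrite lee_fin exprn_ge0.
  + have := measurable_funS (mV k) (AV k) (mg 0).
    by under eq_fun do rewrite addr0.
  rewrite leeD2l// integral_cst// -[X in (_ * X)%E]/(lebesgue_rV R n A) mE.
  by rewrite -EFinM lee_fin.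
have intW : (\int[lebesgue_rV R n]_(z in W k) ((g z + 2 * tau) ^+ n)%:E <=
    (eps / 2)%:E)%E.
  apply: (@le_trans _ _ (\int[lebesgue_rV R n]_(z in W k) cst ((B + 3) ^+ n)%:E z)%E).
    apply: ge0_le_integral => //.
    + by move=> z _; rewrite lee_fin gt0.
    + by apply: measurable_funS (mg _) => // z [].
    + move=> z [/VO[a [Aa _ gza]] _]; rewrite lee_fin lerXn2r ?nnegrE ?addr_ge0//.
      by move: gza; rewrite ltr_norml => /andP[_ ?]; have := gB _ Aa; lra.
  rewrite integral_cst// -[X in (_ * X)%E]/(lebesgue_rV R n (W k)) -(fineK Wk_fin).
  rewrite -EFinM lee_fin mulrC -ler_pdivlMr//; apply: ltW; apply: lt_le_trans Hk _.
  by rewrite /eps' le_eqVlt; apply/orP; left; apply/eqP; field; rewrite gt_eqF//; lra.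
by have := leeD intA intW; rewrite -[leRHS]addeA; exact.
Qed.

End integral_nbhd.

(** * Norms, powers and the degeneracy law *)

Section norms.
Context {R : realType}.

(** The integral of a nonnegative function is a supremum over the simple functions
    below it, hence monotone even for functions which are not known to be
    measurable, such as restrictions to an upper contact set. *)
Lemma le_integral_ge0 d (T : measurableType d) (mu : {measure set T -> \bar R})
    (f1 f2 : T -> \bar R) :
  (forall x, 0 <= f1 x)%E -> (forall x, f1 x <= f2 x)%E ->
  (\int[mu]_x f1 x <= \int[mu]_x f2 x)%E.
Proof.
move=> f10 f12.
have f20 x : (0 <= f2 x)%E by exact: le_trans (f12 x).
rewrite !ge0_integralE//; apply: le_ereal_sup => _ [h /= hf1 <-]; exists h => // x.
apply: le_trans (hf1 x) _; by rewrite !patch_setT.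
Qed.

Lemma le_Lnorm d (T : measurableType d) (mu : {measure set T -> \bar R})
    (f1 f2 : T -> R) (r : R) : 0 <= r ->
  (forall x, `|f1 x| <= `|f2 x|) ->
  (Lnorm mu r%:E (EFin \o f1) <= Lnorm mu r%:E (EFin \o f2))%E.
Proof.
move=> r0 f12; rewrite unlock /=.
have I0 (f : T -> R) : (0 <= \int[mu]_x (`|(f x)%:E| `^ r))%E.
  by apply: integral_ge0 => x _; exact: poweR_ge0.
apply: gt0_ler_poweR; rewrite ?invr_ge0// ?in_itv/= ?I0 ?leey//.
apply: le_integral_ge0 => x; rewrite lee_fin; first exact: powR_ge0.
by apply: ge0_ler_powR; rewrite ?nnegrE.
Qed.

Lemma integral_le_Lnorm_on n (A G : set 'rV[R]_n) (f : 'rV[R]_n -> R) :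
  (0 < n)%N -> A `<=` G -> (forall x, 0 <= f x) ->
  (Lnorm_on G n%:R%:E f < +oo)%E ->
  (\int[lebesgue_rV R n]_(x in A) (f x ^+ n)%:E <=
   (fine (Lnorm_on G n%:R%:E f) ^+ n)%:E)%E.
Proof.
move=> n0 AG f0 foo.
have N0 : (0 <= Lnorm_on G n%:R%:E f)%E by exact: Lnorm_ge0.
rewrite -powR_mulrn ?fine_ge0// -poweR_EFin fineK ?ge0_fin_numE//.
rewrite /Lnorm_on poweR_Lnorm ?pnatr_eq0 -?lt0n// (integral_mkcond A).
apply: le_integral_ge0 => x.
  by apply: erestrict_ge0 => y _; rewrite lee_fin exprn_ge0.
rewrite /= /patch; case: ifPn => [xA|_]; last by rewrite lee_fin powR_ge0.
have -> : x \in G by apply/mem_set/AG/set_mem.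
by rewrite lee_fin powR_mulrn// ger0_norm.
Qed.

(** The absolute value makes one constant serve for both signs of the exponent. *)
Lemma powR_near_scale (a M t : R) : 0 < M -> M / 4 <= t <= 2 * M ->
  4 `^ (- `|a|) * M `^ a <= t `^ a.
Proof.
move=> M0 /andP[tl tu].
have tM0 : 0 < t / M by rewrite divr_gt0//; lra.
have -> : t `^ a = (t / M) `^ a * M `^ a.
  by rewrite -powRM ?(ltW tM0) ?(ltW M0)// divfK// gt_eqF.
rewrite ler_wpM2r ?powR_ge0// /powR !gt_eqF// ler_expR.
have l4 : `|ln (t / M)| <= ln 4.
  rewrite ler_norml -lnV ?posrE//; apply/andP; split; rewrite ler_ln ?posrE//.
    by rewrite ler_pdivlMr//; lra.
  by rewrite ler_pdivrMr//; lra.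
rewrite mulNr lerNl -mulrN -normrN.
apply: (le_trans (ler_norm _)); rewrite normrM normrN ler_wpM2l//.
by rewrite normrN.
Qed.

Lemma Phi_ge n (Omega : set 'rV[R]_n) (iPhi sPhi L nu0 nu1 : R) Phi x t :
  degeneracy_law Omega iPhi sPhi L nu0 nu1 Phi -> Omega x -> 1 <= t ->
  nu0 / L * t `^ iPhi <= Phi x t.
Proof.
move=> [_ _ [_ _ L1] mono [_ nu]] Ox t1.
have [+ _] := mono x Ox; move=> /(_ 1 t ltr01 t1).
rewrite powR1 divr1 => H.
have /andP[nu0x _] := nu x Ox.
have L0 : 0 < L by exact: lt_le_trans L1.
have p0 : 0 < t `^ iPhi by rewrite powR_gt0// (lt_le_trans _ t1).
rewrite mulrAC ler_pdivrMr// -ler_pdivlMr//.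
by apply: (le_trans nu0x); apply: (le_trans H); rewrite mulrA (mulrC L).
Qed.

Lemma continuous_funrneg n (f : 'rV[R]_n -> R) x :
  {for x, continuous f} -> {for x, continuous f^\-}.
Proof.
move=> cf; apply: (@continuous_max R _ (fun x => - f x) (fun _ => 0)).
  exact: continuousN.
exact: cst_continuous.
Qed.

End norms.

(** * The box of slopes *)

Section abp.
Context {R : realType} {n : nat}.
Implicit Types p q x y z : 'rV[R]_n.

(** A cube of slopes whose distance to the origin and whose diameter are in a
    proportion fixed once and for all: a slope that differs from one in the box by
    three times the diameter still has size between [M / 4] and [2 * M]. *)
Definition slope_box (i0 : 'I_n) (M : R) : set 'rV[R]_n :=
  rV_itv true false (\row_i (if i == i0 then M / 2 else 0))
    (\row_i ((if i == i0 then M / 2 else 0) + M / (16 * n%:R))).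

Lemma slope_boxP i0 M p : 0 < M -> slope_box i0 M p -> M / 2 <= enorm p <= M.
Proof.
move=> M0 pM.
have n0 : 0 < n%:R :> R by rewrite ltr0n (leq_ltn_trans _ (ltn_ord i0)).
have dM : 0 < M / (16 * n%:R) by rewrite divr_gt0// mulr_gt0.
have {}pM i : (if i == i0 then M / 2 else 0) <= p ord0 i
    <= (if i == i0 then M / 2 else 0) + M / (16 * n%:R).
  by have := pM i; rewrite !mxE in_itv.
apply/andP; split.
  have /andP[+ _] := pM i0; rewrite eqxx => /le_trans; apply.
  exact: le_trans (ler_norm _) (coord_le_enorm _ _).
apply: (le_trans (enorm_le_sum p)).
apply: (@le_trans _ _ (\sum_(i < n) ((if i == i0 then M / 2 else 0) + M / (16 * n%:R)))).
  apply: ler_sum => i _; have /andP[pi0 pi1] := pM i.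
  by rewrite ger0_norm//; apply: le_trans pi0; case: ifP => // _; lra.
rewrite big_split/= -big_mkcond big_pred1_eq sumr_const card_ord -[_ *+ n]mulr_natr.
have -> : M / (16 * n%:R) * n%:R = M / 16 by field; rewrite gt_eqF.
lra.
Qed.

Lemma slope_box_diam i0 M p q : slope_box i0 M p -> slope_box i0 M q ->
  enorm (p - q) <= M / 16.
Proof.
move=> pM qM.
have n0 : 0 < n%:R :> R by rewrite ltr0n (leq_ltn_trans _ (ltn_ord i0)).
have -> : M / 16 = n%:R * (M / (16 * n%:R)) by field; rewrite gt_eqF.
apply: enorm_le_coord => i; have := pM i; have := qM i; rewrite !mxE !in_itv/=.
by move=> /andP[? ?] /andP[? ?]; rewrite ler_norml; apply/andP; split; lra.
Qed.

Lemma compact_slope_box i0 M : compact (slope_box i0 M).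
Proof.
rewrite /slope_box /rV_itv.
set a := \row_i _; set b := \row_i _.
by apply: (@rV_compact R n (fun i => [set` `[a ord0 i, b ord0 i]])) => i;
  exact: segment_compact.
Qed.

Lemma lebesgue_slope_box i0 M : 0 < M ->
  lebesgue_rV R n (slope_box i0 M) = ((M / (16 * n%:R)) ^+ n)%:E.
Proof.
move=> M0.
have n0 : 0 < n%:R :> R by rewrite ltr0n (leq_ltn_trans _ (ltn_ord i0)).
have dM : 0 < M / (16 * n%:R) by rewrite divr_gt0// mulr_gt0.
rewrite lebesgue_rV_itv; last by move=> i; rewrite !mxE ltrDl.
congr EFin; rewrite (eq_bigr (fun=> M / (16 * n%:R))) ?prodr_const ?card_ord//.
by move=> i _; rewrite !mxE addrC addKr.
Qed.

Lemma compact_closure_bounded (Omega : set 'rV[R]_n) :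
  bounded_set Omega -> compact (closure Omega).
Proof.
move=> [b [_ Hb]]; apply: bounded_closed_compact; last exact: closed_closure.
have sub : closure Omega `<=` [set x | `|x| <= b + 1].
  have cl : closed [set x : 'rV[R]_n | `|x| <= b + 1].
    by apply: closed_le_continuous => x; exact: norm_continuous.
  have sub0 : Omega `<=` [set x | `|x| <= b + 1].
    by move=> x Ox /=; apply: Hb => //; rewrite ltrDl.
  by move=> x /(closure_subset sub0); rewrite -(closure_id _).1.
exists (b + 1); split; first exact: num_real.
by move=> m bm x /sub /= xb; exact: le_trans xb (ltW bm).
Qed.

Lemma enorm_le_diam (Omega : set 'rV[R]_n) x y : bounded_set Omega ->
  Omega x -> closure Omega y -> enorm (y - x) <= diam Omega.
Proof.
move=> [b [_ Hb]] Ox.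
have sub : Omega `<=` [set y | enorm (y - x) <= diam Omega].
  move=> z Oz /=; apply: ub_le_sup; last by exists (z, x).
  exists (n%:R * (b + 1 + (b + 1))) => _ [[v w] [/= Ov Ow] <-].
  apply: (le_trans (enorm_le_norm _)); rewrite ler_wpM2l//.
  apply: (le_trans (ler_normB v w)); apply: lerD; apply: Hb => //;
  by rewrite ltrDl.
have cl : closed [set y | enorm (y - x) <= diam Omega].
  by apply: closed_le_continuous; apply: continuous_enorm; exact: continuous_subv.
move=> clOy; have : closure [set y | enorm (y - x) <= diam Omega] y.
  exact: closure_subset clOy.
by rewrite -(closure_id _).1.
Qed.

End abp.

(** * The contact estimate *)

Section abp_key.
Context {R : realType} {n : nat}.
Implicit Types p q x y z : 'rV[R]_n.

(** [K] is the constant of [contact_slope_gap] for [s = n * r]: [n] passes from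
    the side of a cell to its Euclidean diameter, and the denominator contains the
    lower bound of Phi at slopes of size comparable with [M]. *)
Lemma abp_contact_estimate (Omega : set 'rV[R]_n)
    (lambda Lambda iPhi sPhi L nu0 nu1 : R) (F : 'M[R]_n -> R)
    (Phi : 'rV[R]_n -> R -> R) (f u : 'rV[R]_n -> R) (G M : R) xs :
  (0 < n)%N -> bounded_domain Omega -> elliptic_operator lambda Lambda F ->
  degeneracy_law Omega iPhi sPhi L nu0 nu1 Phi ->
  {within Omega, continuous f} -> {within closure Omega, continuous u} ->
  viscosity_subsolution Phi F f (Omega `&` [set x | 0 < u x]) u ->
  0 <= G -> (forall y, boundary Omega y -> u y <= G) ->
  4 <= M -> Omega xs -> G + M * diam Omega < u xs ->
  let K := 16 * n%:R * L / (lambda * nu0 * 4 `^ (- `|iPhi|) * M `^ iPhi) in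
  exists2 A, A `<=` upper_contact_set Omega u^\+ &
    (((M / (16 * n%:R)) ^+ n)%:E <=
      ((4 * K) ^+ n)%:E * \int[lebesgue_rV R n]_(x in A) (f^\- x ^+ n)%:E)%E.
Proof.
move=> n0 [oO _ _ bO] ell deg cf cu sub G0 uG M4 Oxs uxs K.
have M0 : 0 < M by lra.
have n0R : 0 < n%:R :> R by rewrite ltr0n.
have [/andP[l0 lL] _ _ _] := ell.
have [_ Phi_ge0 [_ _ L1] _ [/andP[nu00 _] _]] := deg.
have k0 : 0 < 4 `^ (- `|iPhi|) :> R by rewrite powR_gt0.
have Mi0 : 0 < M `^ iPhi by rewrite powR_gt0.
have L0 : 0 < L by lra.
have den0 : 0 < lambda * nu0 * 4 `^ (- `|iPhi|) * M `^ iPhi.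
  by do ?apply: mulr_gt0.
have K0 : 0 < K.
  by apply: divr_gt0 => //; apply: mulr_gt0 => //; apply: mulr_gt0.
have Lam0 : 0 < Lambda by exact: lt_le_trans lL.
pose Pi : set 'rV[R]_n := slope_box (Ordinal n0) M.
have cKO := compact_closure_bounded bO.
have cPi : compact Pi by exact: compact_slope_box.
have sub_cl := @subset_closure _ Omega.
have cuO : {in Omega, continuous u}.
  by rewrite -continuous_open_subspace//; exact: continuous_subspaceW cu.
have cfO : {in Omega, continuous f} by rewrite -continuous_open_subspace.
pose O := Omega `&` [set x | 0 < u x].
have oOp : open O.
  rewrite openE => x [Ox ux]; rewrite /interior; apply: filterI; first exact: open_nbhs_nbhs.
  exact: (cvgr_gt _ (cuO x (mem_set Ox))).
pose A := [set x | closure Omega x /\ exists2 p, Pi p &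
                   forall y, closure Omega y -> u y <= u x + dotv p (y - x)].
have cA : compact A by exact: compact_contact_set.
pose S x p := Pi p /\ forall y, closure Omega y -> u y <= u x + dotv p (y - x).
(* such a plane lies above [u] at [xs] and drops by at most [M * diam Omega] to [y] *)
have plane_gt x p y : S x p -> closure Omega y -> G < u x + dotv p (y - x).
  move=> [Pip xp] clOy.
  have H1 := xp xs (sub_cl _ Oxs).
  have H2 : - (M * diam Omega) <= dotv p (y - xs).
    have /andP[_ pM] := slope_boxP M0 Pip.
    have := normr_dotv_le p (y - xs); rewrite ler_norml => /andP[+ _].
    apply: le_trans; rewrite lerN2; apply: ler_pM => //; rewrite ?enorm_ge0//.
    exact: enorm_le_diam.
  rewrite !dotvBr in H1 H2 *; lra.
have plane_self x p : u x + dotv p (x - x) = u x by rewrite subrr dotvC dot0v addr0.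
have AS x : A x -> exists p, S x p by move=> [_ [p Pip xp]]; exists p.
have AO : A `<=` O.
  move=> x [clOx [p Pip xp]].
  have := plane_gt x p x (conj Pip xp) clOx; rewrite plane_self => Gux.
  split; last exact: le_lt_trans Gux.
  have : ~ boundary Omega x by move=> /uG; rewrite leNgt Gux.
  rewrite /boundary /setD/= => nb; apply: interior_subset.
  by apply: contrapT => nint; apply: nb.
have PiA p : Pi p -> exists2 x, A x & S x p.
  move=> Pip.
  have [x /set_mem clOx xmax] : exists2 x, x \in closure Omega &
      forall y, y \in closure Omega -> u y - dotv p (y - xs) <= u x - dotv p (x - xs).
    apply: compact_EVT_max => //; first by exists xs; exact: sub_cl.
    move=> z; apply: (@continuousB _ R^o (subspace (closure Omega)) u
      (fun z => dotv p (z - xs)) z).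
      exact: cu.
    exact: (continuous_subspaceT (@continuous_dotv_sub _ _ p xs)).
  have xp y : closure Omega y -> u y <= u x + dotv p (y - x).
    by move=> clOy; have := xmax y (mem_set clOy); rewrite !dotvBr; lra.
  by exists x => //; split => //; exists p.
exists A.
  move=> x Ax; have [Ox ux] := AO _ Ax; split => //.
  have [p Sp] := AS _ Ax; have [Pip xp] := Sp; exists p => y Oy.
  have clOy := sub_cl _ Oy.
  have -> : u^\+ x = u x by rewrite /funrpos; apply/max_idPl; exact: ltW.
  rewrite /funrpos ge_max xp//=; apply: ltW; apply: le_lt_trans G0 _.
  exact: plane_gt.
apply/lee_addgt0Pr => e e0.
have c2K0 : 0 < (2 * K) ^+ n by rewrite exprn_gt0// mulr_gt0.
pose eps := e / (2 * K) ^+ n.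
have eps0 : 0 < eps by rewrite divr_gt0.
have cg : {in O, continuous f^\-}.
  by move=> x /set_mem[Ox _]; apply: continuous_funrneg; apply: cfO; exact/mem_set.
have g0 x : 0 <= f^\- x by rewrite /funrneg le_max lexx orbT.
have [tau [eta [V [tau0 eta0 [oV VO] nearA intV]]]] :=
  integral_nbhd_le n0 cA oOp AO cg g0 eps0.
(* the gap lemma looks at distance kap * n * r from a contact point; with this r the
   point it finds stays within eta of the contact point *)
pose kap := 32 * n%:R * (Lambda / lambda).
have kap0 : 0 < kap.
  by apply: mulr_gt0; [exact: mulr_gt0|exact: divr_gt0].
pose r := eta / (2 * (1 + kap * n%:R)).
have kn0 : 0 < kap * n%:R by rewrite mulr_gt0.
have r0 : 0 < r by rewrite divr_gt0//; lra.
have r_eta : r * (1 + kap * n%:R) < eta.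
  have -> : r * (1 + kap * n%:R) = eta / 2.
    by rewrite /r; field; rewrite gt_eqF//; lra.
  lra.
have rk0 : 0 < r * (kap * n%:R) by rewrite mulr_gt0.
have [b b0 Ab] := compact_norm_le cA.
have mV : measurable V by exact: measurable_rV_open.
have mg : measurable_fun V (fun z => ((f^\- z + 2 * tau) ^+ n)%:E).
  apply/measurable_EFinP; apply: measurable_funX.
  apply: measurable_funD; last exact: measurable_cst.
  apply: measurable_fun_continuous_open => // x /set_mem Vx.
  by apply: cg; exact/mem_set/VO.
have t20 : 0 <= 2 * tau by lra.
rewrite -(lebesgue_slope_box (Ordinal n0) M0).
have cover : (lebesgue_rV R n Pi <= (2 ^+ n)%:E * \int[lebesgue_rV R n]_(z in V)
    (K ^+ n * (f^\- z + 2 * tau) ^+ n)%:E)%E.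
  apply: (@slope_covering R n A V Pi S (fun x => K * (f^\- x + tau)) _ r b) => //.
  - by move=> x i Ax; exact: le_trans (coord_le_norm x i) (Ab _ Ax).
  - by under eq_fun do rewrite EFinM; exact: measurable_funeM.
  - by move=> z _; rewrite mulr_ge0 ?exprn_ge0 ?addr_ge0// ltW.
  - exact: measurable_rV_itv.
  - by move=> x Ax; rewrite mulr_gt0//; have := g0 x; lra.
  - move=> x z Ax xz.
    have zx : `|z - x| < eta.
      apply: (@le_lt_trans _ _ r); last lra.
      by apply: norm_le_coord => [|i]; [exact: ltW|rewrite !mxE; exact: xz].
    have [Vz gzx] := nearA x z Ax zx; split => //.
    have gx := g0 x; have gz := g0 z.
    rewrite -exprMn; apply: lerXn2r; rewrite ?nnegrE.
    + by apply: mulr_ge0; [exact: ltW|lra].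
    + by apply: mulr_ge0; [exact: ltW|lra].
    + by rewrite ler_pM2l//; move: gzx; rewrite ltr_norml => /andP[? _]; lra.
  move=> x y p q Ax Ay Sp Sq xy i.
  apply: (@le_trans _ _ (enorm (p - q))).
    by have := coord_le_enorm (p - q) i; rewrite !mxE.
  have [g_eq0|g_neq0] := eqVneq (enorm (p - q)) 0.
    rewrite g_eq0; apply: mulr_ge0; first exact: ltW.
    by apply: mulr_ge0; [exact: ltW|have := g0 x; lra].
  have g_gt0 : 0 < enorm (p - q) by rewrite lt_def g_neq0 enorm_ge0.
  have rn0 : 0 < n%:R * r by rewrite mulr_gt0.
  have xy_le : enorm (x - y) <= n%:R * r.
    by apply: enorm_le_coord => j; rewrite !mxE; exact: xy.
  have near_x z : enorm (z - x) <= kap * (n%:R * r) -> V z /\ `|f^\- z - f^\- x| < tau.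
    move=> zx; apply: nearA => //; apply: le_lt_trans (norm_le_enorm _) _.
    by apply: le_lt_trans zx _; rewrite mulrA mulrC; lra.
  have OclO z : O z -> closure Omega z by move=> [/sub_cl].
  have [Pip xp] := Sp; have [Piq yq] := Sq.
  have cuO' : {within O, continuous u}.
    by apply: continuous_subspaceW cu => z /OclO.
  have [z [P [zx Pp gap]]] := contact_slope_gap n0 ell
    (fun z t (Oz : O z) t0 => Phi_ge0 z t Oz.1 t0) sub cuO' rn0 xy_le g_gt0
    (fun z zx => VO _ (near_x z zx).1) (AO _ Ay)
    (fun z Oz => xp z (OclO _ Oz)) (fun z Oz => yq z (OclO _ Oz)).
  have [Vz gzx] := near_x _ zx.
  have [Oz _] := VO _ Vz.
  have pq := slope_box_diam Pip Piq.
  have /andP[pM1 pM2] := slope_boxP M0 Pip.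
  have P_le : enorm P <= enorm p + enorm (P - p).
    by have := enormD p (P - p); rewrite addrC subrK.
  have P_ge : enorm p <= enorm P + enorm (P - p).
    by have := enormD P (p - P); rewrite addrC subrK enormB.
  have PM : M / 4 <= enorm P <= 2 * M by apply/andP; split; lra.
  have PhiP : nu0 / L * (4 `^ (- `|iPhi|) * M `^ iPhi) <= Phi z (enorm P).
    have P1 : 1 <= enorm P by move: PM => /andP[? _]; lra.
    apply: le_trans (Phi_ge deg Oz P1); rewrite ler_pM2l ?divr_gt0//.
    exact: powR_near_scale.
  have c0 : 0 <= lambda * enorm (p - q) / (16 * (n%:R * r)).
    by apply: ltW; apply: divr_gt0; apply: mulr_gt0.
  have H : lambda * enorm (p - q) / (16 * (n%:R * r)) *
      (nu0 / L * (4 `^ (- `|iPhi|) * M `^ iPhi)) <= f^\- x + tau.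
    apply: le_trans (ler_wpM2l c0 PhiP) _; apply: le_trans gap _.
    have : - f z <= f^\- z by rewrite /funrneg le_max lexx.
    by move: gzx; rewrite ltr_norml => /andP[_ ?]; lra.
  have -> : enorm (p - q) = r * (K * (lambda * enorm (p - q) / (16 * (n%:R * r)) *
      (nu0 / L * (4 `^ (- `|iPhi|) * M `^ iPhi)))).
    by rewrite /K; field; rewrite !gt_eqF.
  by rewrite ler_pM2l// ler_pM2l.
apply: le_trans cover _.
under eq_integral do rewrite EFinM.
rewrite ge0_integralZl_EFin ?exprn_ge0 ?(ltW K0)//; last first.
  by move=> z _; rewrite lee_fin exprn_ge0// addr_ge0.
rewrite muleA -EFinM -exprMn.
have c2K : (0 <= ((2 * K) ^+ n)%:E)%E by rewrite lee_fin ltW.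
apply: le_trans (lee_wpmul2l c2K intV) _.
rewrite ge0_muleDr; last 2 first.
- apply: mule_ge0; first by rewrite lee_fin exprn_ge0.
  by apply: integral_ge0 => x _; rewrite lee_fin exprn_ge0.
- by rewrite lee_fin ltW.
rewrite muleA -!EFinM -exprMn.
have -> : (2 * K) ^+ n * eps = e by rewrite /eps; field; rewrite gt_eqF.
by have -> : 2 * K * 2 = 4 * K by ring.
Qed.

End abp_key.

(** * The upper bound *)

Section final.
Context {R : realType} {n : nat}.
Implicit Types p q x y z : 'rV[R]_n.

(** The contact estimate gives M^(i+1) <= C N; the second term is C^(1/(i+1)), and 4
    keeps the slopes used in the proof at size at least 1. *)
Definition abp_const (m : nat) (lambda iPhi L nu0 : R) : R :=
  Num.max 4 ((64 * m%:R * (16 * m%:R * L / (lambda * nu0 * 4 `^ (- `|iPhi|))))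
    `^ (iPhi + 1)^-1).

Lemma abp_const_gt0 m lambda iPhi L nu0 : 0 < abp_const m lambda iPhi L nu0.
Proof. by rewrite lt_max ltr0n. Qed.

Lemma funrpos_ge0 T (h : T -> R) t : 0 <= h^\+ t.
Proof. by rewrite /funrpos le_max lexx orbT. Qed.

Lemma funrneg_ge0 T (h : T -> R) t : 0 <= h^\- t.
Proof. by rewrite /funrneg le_max lexx orbT. Qed.

Lemma sup_image_ge0 T (h : T -> R) (B : set T) : (forall t, 0 <= h t) ->
  0 <= sup (h @` B).
Proof.
move=> h0; have [|] := pselect (has_sup (h @` B)); last by move/sup_out => ->.
by move=> [[_ [t Bt _]] ub]; apply: le_trans (h0 t) _; apply: ub_le_sup => //; exists t.
Qed.

Lemma Lnorm_on_le (p : R) (A B : set 'rV[R]_n) (h k : 'rV[R]_n -> R) :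
  0 <= p -> A `<=` B -> (forall x, `|h x| <= `|k x|) ->
  (Lnorm_on A p%:E h <= Lnorm_on B p%:E k)%E.
Proof.
move=> p0 AB hk; apply: le_Lnorm => // x; rewrite /patch.
case: ifPn => [xA|_]; last by rewrite normr0.
by have -> : x \in B by apply/mem_set/AB/set_mem.
Qed.

Lemma normr_funrneg_le T (h : T -> R) t : `|h^\- t| <= `|h t|.
Proof.
rewrite ger0_norm ?funrneg_ge0// /funrneg ge_max normr_ge0 andbT -normrN.
exact: ler_norm.
Qed.

Lemma upper_contact_set_sub (Omega : set 'rV[R]_n) v : upper_contact_set Omega v `<=` Omega.
Proof. by move=> x []. Qed.

Lemma max_power_ge0 (i s N : R) : 0 <= max_power i s N.
Proof. by rewrite le_max powR_ge0. Qed.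

Lemma max_power_le (i s N N' : R) : -1 < i -> i <= s -> 0 <= N -> N <= N' ->
  max_power i s N <= max_power i s N'.
Proof.
move=> i1 is_ N0 NN; have N'0 : 0 <= N' by exact: le_trans NN.
rewrite /max_power ge_max !le_max; apply/andP; split; apply/orP; [left|right];
  apply: ge0_ler_powR; rewrite ?nnegrE ?invr_ge0//; lra.
Qed.

(** If the bound failed at [x], the contact estimate would hold with
    [M = c (max_power N + 1)] and give [M^(i+1) <= C N]. But [M > c N^(1/(i+1))],
    so that [M^(i+1) > c^(i+1) N], and [c^(i+1) >= C] by the choice of [c]. *)
Lemma abp_upper (lambda Lambda iPhi sPhi L nu0 nu1 : R)
    (Omega : set 'rV[R]_n) (F : 'M[R]_n -> R)
    (Phi : 'rV[R]_n -> R -> R) (f u g : 'rV[R]_n -> R) :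
  (0 < n)%N -> bounded_domain Omega -> elliptic_operator lambda Lambda F ->
  degeneracy_law Omega iPhi sPhi L nu0 nu1 Phi ->
  {within Omega, continuous f} ->
  (Lnorm_on Omega n%:R%:E f < +oo)%E ->
  {within closure Omega, continuous u} ->
  {in boundary Omega, u =1 g} ->
  viscosity_subsolution Phi F f (Omega `&` [set x | 0 < u x]) u ->
  forall x, Omega x ->
  u x <= sup (g^\+ @` boundary Omega) + abp_const n lambda iPhi L nu0 * diam Omega *
    (max_power iPhi sPhi
      (fine (Lnorm_on (upper_contact_set Omega u^\+) n%:R%:E f^\-)) + 1).
Proof.
move=> n0 dom ell deg cf foo cu ug sub x Ox.
have [_ _ _ bO] := dom.
have n0R : 0 < n%:R :> R by rewrite ltr0n.
have [/andP[l0 lL] _ _ _] := ell.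
have [_ Phi_ge0 [i1 is_ L1] _ [/andP[nu00 _] _]] := deg.
have k0 : 0 < 4 `^ (- `|iPhi|) :> R by rewrite powR_gt0.
have L0 : 0 < L by lra.
have G0 : 0 <= sup (g^\+ @` boundary Omega) by apply: sup_image_ge0; exact: funrpos_ge0.
have uG y : boundary Omega y -> u y <= sup (g^\+ @` boundary Omega).
  move=> By; apply: (@le_trans _ _ (g^\+ y)).
    by rewrite (ug y (mem_set By)) /funrpos le_max lexx.
  apply: ub_le_sup; last by exists y.
  have [m _ um] : exists2 m, m \in closure Omega &
      forall t, t \in closure Omega -> u t <= u m.
    apply: compact_EVT_max => //; last exact: compact_closure_bounded.
    by exists x; exact: subset_closure.
  exists (Num.max (u m) 0) => _ [z Bz <-].
  rewrite /funrpos -(ug z (mem_set Bz)) ge_max !le_max lexx orbT andbT.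
  by rewrite um//; apply/mem_set; case: Bz.
set N := fine _; set c := abp_const _ _ _ _ _.
have N0 : 0 <= N by apply: fine_ge0; exact: Lnorm_ge0.
have c4 : 4 <= c by rewrite le_max lexx.
pose M := c * (max_power iPhi sPhi N + 1).
have mp0 := max_power_ge0 iPhi sPhi N.
have M4 : 4 <= M by rewrite /M -[4]mulr1; apply: ler_pM => //; lra.
have M0 : 0 < M by lra.
rewrite leNgt; apply/negP => ux.
have {}ux : sup (g^\+ @` boundary Omega) + M * diam Omega < u x.
  by rewrite /M mulrAC.
have [A AG] := abp_contact_estimate n0 dom ell deg cf cu sub G0 uG M4 Ox ux.
set K := 16 * n%:R * L / _ => estimate.
have Mi0 : 0 < M `^ iPhi by rewrite powR_gt0.
pose K1 := 16 * n%:R * L / (lambda * nu0 * 4 `^ (- `|iPhi|)).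
have den0 : 0 < lambda * nu0 * 4 `^ (- `|iPhi|) by apply: mulr_gt0 => //; exact: mulr_gt0.
have K10 : 0 < K1.
  by apply: divr_gt0 => //; apply: mulr_gt0 => //; exact: mulr_gt0.
have KE : K = K1 / M `^ iPhi.
  by rewrite /K /K1; field; rewrite !gt_eqF.
have K0 : 0 < K by rewrite KE divr_gt0.
have foo' : (Lnorm_on (upper_contact_set Omega (u^\+)%R) n%:R%:E (f^\-)%R < +oo)%E.
  apply: le_lt_trans foo; apply: Lnorm_on_le => //.
    exact: upper_contact_set_sub.
  exact: normr_funrneg_le.
have intA := integral_le_Lnorm_on n0 AG (funrneg_ge0 f) foo'.
have c4K : (0 <= ((4 * K) ^+ n)%:E)%E by rewrite lee_fin exprn_ge0// mulr_ge0// ltW.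
have := le_trans estimate (lee_wpmul2l c4K intA).
rewrite -EFinM lee_fin -exprMn -/N ler_pXn2r ?nnegrE//; last 2 first.
- by apply: ltW; apply: divr_gt0 => //; exact: mulr_gt0.
- by apply: mulr_ge0 => //; apply: mulr_ge0 => //; exact: ltW.
move=> MN.
have i10 : 0 < iPhi + 1 by lra.
have MpE : M `^ (iPhi + 1) = M `^ iPhi * M.
  by rewrite powRD ?powRr1 ?(ltW M0)// (gt_eqF M0) implybT.
pose C1 := 64 * n%:R * K1.
have C10 : 0 < C1 by apply: mulr_gt0 => //; exact: mulr_gt0.
have upper : M `^ (iPhi + 1) <= C1 * N.
  rewrite MpE.
  have -> : M = 16 * n%:R * (M / (16 * n%:R)) by field; rewrite gt_eqF.
  have d0 : 0 <= M `^ iPhi * (16 * n%:R).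
    by apply: ltW; apply: mulr_gt0 => //; exact: mulr_gt0.
  have := ler_wpM2l d0 MN.
  have -> : M `^ iPhi * (16 * n%:R) * (4 * K * N) = C1 * N.
    by rewrite KE /C1; field; rewrite gt_eqF.
  have E16 : 16 * n%:R * (M / (16 * n%:R)) = M by field; rewrite gt_eqF.
  by rewrite E16 -mulrA E16.
have lower : C1 * N < M `^ (iPhi + 1).
  have c_C1 : C1 `^ (iPhi + 1)^-1 <= c by rewrite /c /abp_const le_max lexx orbT.
  have -> : C1 * N = (C1 `^ (iPhi + 1)^-1 * N `^ (iPhi + 1)^-1) `^ (iPhi + 1).
    rewrite powRM ?powR_ge0// -!powRrM mulVf ?gt_eqF// !powRr1//.
    exact: ltW.
  apply: gt0_ltr_powR => //; rewrite ?nnegrE.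
  - by apply: mulr_ge0; exact: powR_ge0.
  - exact: ltW.
  rewrite /M; apply: (@le_lt_trans _ _ (c * N `^ (iPhi + 1)^-1)).
    by rewrite ler_wpM2r ?powR_ge0.
  rewrite ltr_pM2l; last lra.
  by apply: (@le_lt_trans _ _ (max_power iPhi sPhi N)); [rewrite le_max lexx|lra].
by move: upper; rewrite leNgt lower.
Qed.

End final.

(** * Reflection, and the two-sided estimate *)

Section reflection.
Context {R : realType} {n : nat}.
Implicit Types p q x y z : 'rV[R]_n.

Lemma derivable_opp (phi : 'rV[R]_n -> R) x v :
  derivable (- phi) x v <-> derivable phi x v.
Proof.
split => [H|]; last exact: derivableN.
by rewrite -[phi]opprK; exact: derivableN.
Qed.

(** Holds also where the derivative does not exist: both sides are then the
    default value 0. This makes [partial i (- phi)] and [- partial i phi] equal as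
    functions, so that it can be iterated for second derivatives. *)
Lemma partial_opp i (phi : 'rV[R]_n -> R) : partial i (- phi) = - partial i phi.
Proof.
apply/funext => x; rewrite /partial -[RHS]/(- 'D_(delta_mx ord0 i) phi x).
have [d|nd] := pselect (derivable phi x (delta_mx ord0 i)); first exact: deriveN.
have D0 (h : 'rV[R]_n -> R) v : ~ derivable h x v -> 'D_v h x = 0.
  by move=> H; exact: dvgP.
by rewrite !D0 ?oppr0// => /derivable_opp.
Qed.

Lemma C1_on_opp U (phi : 'rV[R]_n -> R) : C1_on U phi -> C1_on U (- phi).
Proof.
move=> [c d]; split => [x Ux|i]; first by apply: continuousN; exact: c.
have [d1 d2] := d i; split => x Ux; first by apply: derivableN; exact: d1.
by rewrite partial_opp; apply: continuousN; exact: d2.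
Qed.

Lemma C2_on_opp U (phi : 'rV[R]_n -> R) : C2_on U phi -> C2_on U (- phi).
Proof.
move=> [c d]; split; first exact: C1_on_opp.
by move=> i; rewrite partial_opp; apply: C1_on_opp.
Qed.

Lemma gradient_opp (phi : 'rV[R]_n -> R) x : gradient (- phi) x = - gradient phi x.
Proof. by apply/rowP => i; rewrite !mxE partial_opp. Qed.

Lemma hessian_opp (phi : 'rV[R]_n -> R) x : hessian (- phi) x = - hessian phi x.
Proof. by apply/matrixP => i j; rewrite !mxE !partial_opp. Qed.

Definition dual_operator (F : 'M[R]_n -> R) (M : 'M[R]_n) : R := - F (- M).

Lemma Sym_opp (M : 'M[R]_n) : Sym M -> Sym (- M).
Proof. by move=> /SymE MT; apply/SymE; rewrite linearN/= MT. Qed.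

Lemma elliptic_dual lambda Lambda (F : 'M[R]_n -> R) :
  elliptic_operator lambda Lambda F ->
  elliptic_operator lambda Lambda (dual_operator F).
Proof.
move=> [lL cF F0 ell]; split => //.
- apply/subspace_continuousP => M sM; apply: cvgN.
  have cFM := (subspace_continuousP _ _).1 cF (- M) (Sym_opp sM).
  apply: cvg_trans cFM.
  suff : (fun N : 'M[R]_n => - N) @ within (Sym (n:=n)) (nbhs M) -->
      within (Sym (n:=n)) (nbhs (- M)) by move=> H; exact: (cvg_app F H).
  move=> B; rewrite /within /nbhs/= => HB.
  have cN : - N @[N --> M] --> - M by exact: (@cvgN _ 'M[R]_n _ (nbhs M) _ _ _ cvg_id).
  have {}HB := cN _ HB; near=> N => sN.
  have : Sym (- N) -> B (- N) by near: N; exact: HB.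
  by apply; exact: Sym_opp.
- by rewrite /dual_operator oppr0 F0 oppr0.
- move=> M N sM sN pN; rewrite /dual_operator opprD.
  have sMN : Sym (- M - N).
    by rewrite /Sym -opprD; apply: Sym_opp; apply/SymE; rewrite linearD/= !(SymE _).1.
  have := ell (- M - N) N sMN sN pN; rewrite subrK; lra.
Unshelve. all: by end_near. Qed.

Lemma supersolution_opp (Phi : 'rV[R]_n -> R -> R) (F : 'M[R]_n -> R)
    (f u : 'rV[R]_n -> R) (U : set 'rV[R]_n) :
  viscosity_supersolution Phi F f U u ->
  viscosity_subsolution Phi (dual_operator F) (- f) U (- u).
Proof.
move=> [lscu super]; split; first by rewrite /usc_on opprK.
move=> phi x0 cphi Ux0 lmax.
have lmin : local_min (u - - phi) x0.
  rewrite /local_min; near=> x.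
  have : (- u - phi) x <= (- u - phi) x0 by near: x; exact: lmax.
  rewrite -[(- u - phi) x]/(- u x - phi x) -[(- u - phi) x0]/(- u x0 - phi x0).
  rewrite -[(u - - phi) x]/(u x - - phi x) -[(u - - phi) x0]/(u x0 - - phi x0).
  lra.
have := super (- phi) x0 (C2_on_opp cphi) Ux0 lmin.
rewrite gradient_opp hessian_opp enormN /dual_operator -[(- f) x0]/(- f x0).
lra.
Unshelve. all: by end_near. Qed.

End reflection.

Theorem theorem3p2 (R : realType) (n : nat) (lambda iPhi sPhi L nu0 : R)
    (n_ge2 : (2 <= n)%N) (lambda_gt0 : 0 < lambda) (iPhi_gtN1 : -1 < iPhi)
    (iPhi_le_sPhi : iPhi <= sPhi) (L_ge1 : 1 <= L) (nu0_gt0 : 0 < nu0) :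
  exists2 c : R, 0 < c &
  forall (Omega : set 'rV[R]_n) (Lambda nu1 : R) (F : 'M[R]_n -> R)
    (Phi : 'rV[R]_n -> R -> R) (f u g : 'rV[R]_n -> R),
    bounded_domain Omega ->
    elliptic_operator lambda Lambda F ->
    degeneracy_law Omega iPhi sPhi L nu0 nu1 Phi ->
    {within Omega, continuous f} ->
    (Lnorm_on Omega n%:R%:E f < +oo)%E ->
    {within closure Omega, continuous u} ->
    {in boundary Omega, u =1 g} ->
    let subsol :=
      viscosity_subsolution Phi F f (Omega `&` [set x | 0 < u x]) u in
    let supersol :=
      viscosity_supersolution Phi F f (Omega `&` [set x | u x < 0]) u in
    [/\ subsol ->
          sup (u @` Omega) <=
          sup (g^\+ @` boundary Omega) + c * diam Omega *
            (max_power iPhi sPhi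
               (fine (Lnorm_on (upper_contact_set Omega u^\+) n%:R%:E f^\-))
             + 1),
        supersol ->
          sup (u^\- @` Omega) <=
          sup (g^\- @` boundary Omega) + c * diam Omega *
            (max_power iPhi sPhi
               (fine (Lnorm_on (upper_contact_set Omega u^\-) n%:R%:E f^\+))
             + 1)
      & subsol -> supersol ->
          (Lnorm_on Omega +oo u <=
           (sup [set `|g x| | x in boundary Omega] + c * diam Omega *
              (max_power iPhi sPhi (fine (Lnorm_on Omega n%:R%:E f)) + 1))%:E)%E].
Proof.
exists (abp_const n lambda iPhi L nu0); first exact: abp_const_gt0.
move=> Omega Lambda nu1 F Phi f u g dom ell deg cf foo cu ug subsol supersol.
have n0 : (0 < n)%N by exact: ltn_trans n_ge2.
have [_ _ [x0 Ox0] bO] := dom.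
set c := abp_const _ _ _ _ _.
have c0 : 0 < c by exact: abp_const_gt0.
have d0 : 0 <= diam Omega.
  apply: le_trans (enorm_ge0 _) (enorm_le_diam bO Ox0 _).
  exact: (subset_closure Ox0).
have rest_ge0 i s (N : R) : 0 <= c * diam Omega * (max_power i s N + 1).
  by rewrite mulr_ge0 ?addr_ge0 ?max_power_ge0// mulr_ge0// ltW.
have upper : subsol -> forall x, Omega x -> u x <= _ :=
  fun sub => abp_upper n0 dom ell deg cf foo cu ug sub.
have foppE : ((- f)^\- = f^\+)%R.
  by apply/funext => x; rewrite /funrneg /funrpos -[(- f) x]/(- f x) opprK.
have lower : supersol -> forall x, Omega x -> - u x <= sup (g^\- @` boundary Omega)
    + c * diam Omega * (max_power iPhi sPhi
      (fine (Lnorm_on (upper_contact_set Omega u^\-) n%:R%:E f^\+)) + 1).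
  move=> sup.
  have cf' : {within Omega, continuous (- f)}.
    by move=> x; apply: (@continuousN _ R^o (subspace Omega) f x); exact: cf.
  have cu' : {within closure Omega, continuous (- u)}.
    by move=> x; apply: (@continuousN _ R^o (subspace (closure Omega)) u x); exact: cu.
  have foo' : (Lnorm_on Omega n%:R%:E (- f)%R < +oo)%E.
    apply: le_lt_trans foo; apply: Lnorm_on_le => // x.
    by rewrite -[(- f) x]/(- f x) normrN.
  have ug' : {in boundary Omega, - u =1 - g}.
    by move=> x Bx; rewrite -[(- u) x]/(- u x) -[(- g) x]/(- g x) ug.
  have := supersolution_opp sup.
  rewrite (_ : [set x | u x < 0] = [set x | 0 < (- u) x]); last first.
    by apply/seteqP; split => x /=; rewrite -[(- u) x]/(- u x) oppr_gt0.
  move=> sub' x Ox.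
  have := abp_upper n0 dom (elliptic_dual ell) deg cf' foo' cu' ug' sub' Ox.
  by rewrite foppE.
split.
- move=> sub; apply: ge_sup; first by exists (u x0), x0.
  by move=> _ [x Ox <-]; exact: upper.
- move=> super; apply: ge_sup; first by exists (u^\- x0), x0.
  move=> _ [x Ox <-]; rewrite /funrneg ge_max lower//=.
  by rewrite addr_ge0// sup_image_ge0//; exact: funrneg_ge0.
move=> sub super.
set B := _ + _.
have N0 (A : set 'rV[R]_n) h : 0 <= fine (Lnorm_on A n%:R%:E h).
  by apply: fine_ge0; exact: Lnorm_ge0.
have gB y : boundary Omega y -> `|g y| <= sup [set `|g x| | x in boundary Omega].
  move=> By; apply: ub_le_sup; last by exists y.
  have cnu : {within closure Omega, continuous (fun x => `|u x|)}.
    by move=> x; apply: (@cvg_norm _ R^o); exact: cu.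
  have [m _ um] : exists2 m, m \in closure Omega &
      forall t, t \in closure Omega -> `|u t| <= `|u m|.
    apply: compact_EVT_max => //; last exact: compact_closure_bounded.
    by exists x0; exact: subset_closure.
  exists `|u m| => _ [z Bz <-]; rewrite -ug; last exact/mem_set.
  by apply: um; apply/mem_set; case: Bz.
have sup_le (h : 'rV[R]_n -> R) : (forall y, h y <= `|g y|) ->
    sup (h @` boundary Omega) <= sup [set `|g x| | x in boundary Omega].
  move=> hg; have [->|/set0P[y By]] := eqVneq (boundary Omega) set0.
    by rewrite !image_set0.
  apply: ge_sup; first by exists (h y), y.
  by move=> _ [z Bz <-]; apply: le_trans (hg z) (gB z Bz).
have rest_le A (h : 'rV[R]_n -> R) : A `<=` Omega -> (forall y, `|h y| <= `|f y|) ->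
    c * diam Omega * (max_power iPhi sPhi (fine (Lnorm_on A n%:R%:E h)) + 1) <=
    c * diam Omega * (max_power iPhi sPhi (fine (Lnorm_on Omega n%:R%:E f)) + 1).
  move=> AO hf; rewrite ler_wpM2l ?mulr_ge0// ?(ltW c0)// lerD2r.
  have le := Lnorm_on_le (ler0n R n) AO hf.
  apply: max_power_le => //; apply: fine_le => //; rewrite ge0_fin_numE ?Lnorm_ge0//.
  exact: le_lt_trans foo.
have B0 : 0 <= B by rewrite addr_ge0// sup_image_ge0.
have uB x : Omega x -> `|u x| <= B.
  move=> Ox; rewrite ler_norml lerNl; apply/andP; split.
    apply: le_trans (lower super x Ox) _; apply: lerD.
      by apply: sup_le => y; rewrite -[leLHS]ger0_norm ?funrneg_ge0// normr_funrneg_le.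
    apply: rest_le => [|y]; first exact: upper_contact_set_sub.
    rewrite -foppE; apply: le_trans (normr_funrneg_le _ _) _.
    by rewrite -[(- f) y]/(- f y) normrN.
  apply: le_trans (upper sub x Ox) _; apply: lerD.
    apply: sup_le => y; rewrite /funrpos ge_max normr_ge0 andbT; exact: ler_norm.
  apply: rest_le => [|y]; first exact: upper_contact_set_sub.
  exact: normr_funrneg_le.
rewrite /Lnorm_on unlock /=; case: ifPn => _; last by rewrite lee_fin.
apply/ess_supP; apply: nearW => x /=; rewrite lee_fin /patch.
by case: ifPn => [/set_mem/uB//|_]; rewrite normr0.
Qed.
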